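(* Let $d\ge1$ be an integer and $0<s<d$. There exists a constant $c>0$ depending only on $d$ and $s$ such that for every compact set $E\subset\mathbb{R}^d$, $$\gamma_{s,+}(E)\ge c\,\sup_{\mu}\ \|\mu\|^{3/2}\Big[\int_{\mathbb{R}^d}W^\mu(x)\,d\mu(x)\Big]^{-1/2},\qquad W^\mu(x):=\int_0^\infty\Big[\frac{\mu(B(x,r))}{r^s}\Big]^2\frac{dr}{r},$$ where the supremum is taken over all (nonzero) positive Radon measures $\mu$ supported by $E$.
   Context: $B(x,r)=\{y\in\mathbb{R}^d:|y-x|<r\}$. If $\int W^\mu\,d\mu=+\infty$ the corresponding term in the supremum is $0$; the supremum over the empty family is $0$. For a compact set $E\subset\mathbb{R}^d$, $M_+(E)$ is the class of positive Radon measures supported by $E$, and $\|\mu\|$ is the total mass of $\mu$. For $\mu\in M_+(E)$, $$R^s_\mu(x)=\lim_{\varepsilon\to0+}\int_{|y-x|>\varepsilon}\frac{y-x}{|y-x|^{s+1}}\,d\mu(y),$$ which for $0<s<d$ exists for Lebesgue-almost every $x\in\mathbb{R}^d$. The capacity $\gamma_{s,+}$ is $$\gamma_{s,+}(E)=\sup\{\|\mu\|:\ \mu\in M_+(E),\ \|R^s_\mu\|_\infty\le1\},$$ where $\|\cdot\|_\infty$ is the $L^\infty$ norm with respect to Lebesgue measure on $\mathbb{R}^d$. *)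

(* Defs.v *)
From HB Require Import structures.
From mathcomp Require Import all_boot all_order all_algebra.
From mathcomp Require Import all_classical all_reals all_analysis.
From mathcomp Require Import measurable_realfun.

Set Implicit Arguments.
Unset Strict Implicit.
Unset Printing Implicit Defensive.

Import Order.TTheory GRing.Theory Num.Theory.
Import numFieldTopology.Exports numFieldNormedType.Exports.

Local Open Scope classical_set_scope.
Local Open Scope ring_scope.

(* R^n is the topological space 'rV[R]_n with its Borel sigma-algebra. *)
HB.instance Definition _ (R : realType) (n : nat) :=
  Measurable.copy 'rV[R]_n (g_sigma_algebraType (@open 'rV[R]_n)).

Section borel_rV.
Context {R : realType}.

Lemma open_measurable_rV n (U : set 'rV[R]_n) : open U -> measurable U.
Proof. exact: sub_sigma_algebra. Qed.

Lemma measurable_coord n (i : 'I_n) :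
  measurable_fun [set: 'rV[R]_n] (fun x : 'rV[R]_n => x 0 i).
Proof.
apply: (measurability _ (RGenOpens.measurableE R)) => _ [_ [a [b ->] <-]].
rewrite setTI; apply: open_measurable_rV.
apply: open_comp; last exact: interval_open.
by move=> x _; exact: coord_continuous.
Qed.

Lemma measurable_fun_rV d (T : measurableType d) n (f : T -> 'rV[R]_n) :
  (forall i, measurable_fun [set: T] (fun t => f t 0 i)) ->
  measurable_fun [set: T] f.
Proof.
move=> mf; apply: (measurability (@open 'rV[R]_n)) => //.
move=> _ [U oU <-]; rewrite setTI.
pose c (q : 'rV[rat]_n) (k : nat) : set 'rV[R]_n :=
  [set y | forall i, ball (ratr (q 0 i) : R) k.+1%:R^-1 (y 0 i)].
have -> : f @^-1` U = \bigcup_(p in [set p : 'rV[rat]_n * nat | c p.1 p.2 `<=` U])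
    (f @^-1` c p.1 p.2).
  apply/seteqP; split => [t Ut|t [p/= pU tp]]; last exact: pU.
  have : nbhs (f t) U by exact: open_nbhs_nbhs.
  move=> /nbhs_ballP[e/= e0 eU].
  have [k ke] : exists k : nat, k.+1%:R^-1 < e / 2.
    have /ltr_add_invr[k] : 0 < e / 2 by rewrite divr_gt0.
    by rewrite add0r; exists k.
  have k0 : 0 < k.+1%:R^-1 :> R by rewrite invr_gt0.
  have /choice[q hq] : forall i, exists q : rat,
      ball (f t 0 i) k.+1%:R^-1 (ratr q : R).
    move=> i; have [||x [xb [q _ qx]]] := @dense_rat R (ball (f t 0 i) k.+1%:R^-1).
    - by exists (f t 0 i); exact: ballxx.
    - exact: ball_open.
    - by exists q; rewrite qx.
  exists (\row_i q i, k) => /=; last by move=> i; rewrite mxE; exact: ball_sym.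
  move=> y cy; apply: eU; split=> // i j; rewrite ord1.
  apply: (@le_ball _ _ _ (k.+1%:R^-1 + k.+1%:R^-1)).
    by rewrite (splitr e) ltW// ltrD.
  by apply: ball_triangle; [exact: (hq j)|have := cy j; rewrite mxE].
rewrite bigcup_mkcond; apply: countable_bigcupT_measurable => //.
move=> [q k]; case: ifPn => // _.
have -> : f @^-1` c q k =
    \bigcap_(i in [set: 'I_n]) ((fun t => f t 0 i) @^-1` ball (ratr (q 0 i) : R) k.+1%:R^-1).
  by apply/seteqP; split => t /= h i; [move=> _; exact: h|exact: h].
apply: fin_bigcap_measurable => // i _.
by rewrite -[X in measurable X]setTI; apply: mf => //; apply: open_measurable; exact: ball_open.
Qed.

End borel_rV.

Section lebesgue_rV.
Context {R : realType}.

Definition rV_cons n (p : R * 'rV[R]_n) : 'rV[R]_n.+1 :=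
  \row_(i < n.+1) (if unlift ord0 i is Some j then p.2 0 j else p.1).

Definition rV_uncons n (x : 'rV[R]_n.+1) : R * 'rV[R]_n :=
  (x 0 ord0, \row_(j < n) x 0 (lift ord0 j)).

Lemma rV_consK n : cancel (@rV_cons n) (@rV_uncons n).
Proof.
move=> [a y]; rewrite /rV_uncons/rV_cons !mxE unlift_none; congr pair.
by apply/rowP => j; rewrite !mxE liftK.
Qed.

Lemma measurable_rV_cons n : measurable_fun [set: R * 'rV[R]_n] (@rV_cons n).
Proof.
apply: measurable_fun_rV => i.
under eq_fun do rewrite mxE.
case: unliftP => [j _|_]; last exact: measurable_fst.
by apply: (measurableT_comp (measurable_coord j)); exact: measurable_snd.
Qed.

Lemma measurable_rV_uncons n : measurable_fun [set: 'rV[R]_n.+1] (@rV_uncons n).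
Proof.
apply: measurable_fun_pair; first exact: measurable_coord.
apply: measurable_fun_rV => i.
by under eq_fun do rewrite mxE; exact: measurable_coord.
Qed.

Section step.
Variables (n : nat) (m : {sigma_finite_measure set 'rV[R]_n -> \bar R}).
Local Open Scope ereal_scope.

Definition lebesgue_rV_step (A : set 'rV[R]_n.+1) : \bar R :=
  pushforward (lebesgue_measure \x m) (@rV_cons n) A.

Let mpre A : measurable A -> measurable (@rV_cons n @^-1` A).
Proof. by move=> mA; rewrite -[X in measurable X]setTI; exact: measurable_rV_cons. Qed.

Let step0 : lebesgue_rV_step set0 = 0.
Proof. by rewrite /lebesgue_rV_step /pushforward preimage_set0 measure0. Qed.

Let step_ge0 A : 0 <= lebesgue_rV_step A.
Proof. exact: (measure_ge0 (lebesgue_measure \x m)). Qed.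

Let step_sigma_additive : semi_sigma_additive lebesgue_rV_step.
Proof.
move=> F mF tF mUF; rewrite /lebesgue_rV_step /pushforward preimage_bigcup.
apply: measure_semi_sigma_additive.
- by move=> i; exact: mpre.
- apply/trivIsetP => /= i j _ _ ij; rewrite -preimage_setI.
  by move/trivIsetP : tF => /(_ _ _ _ _ ij) ->//; rewrite preimage_set0.
- by rewrite -preimage_bigcup; exact: mpre.
Qed.

HB.instance Definition _ := isMeasure.Build _ _ _ lebesgue_rV_step
  step0 step_ge0 step_sigma_additive.

Let step_sigma_finite : sigma_finite setT lebesgue_rV_step.
Proof.
have /sigma_finiteP[F [TF ndF Foo]] := sigma_finiteT (@lebesgue_measure R).
have /sigma_finiteP[G [TG ndG Goo]] := sigma_finiteT m.
exists (fun k => @rV_uncons n @^-1` (F k `*` G k)).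
  rewrite -preimage_bigcup (_ : \bigcup_k _ = setT) ?preimage_setT//.
  rewrite -setXTT TF TG; apply/seteqP; split => -[x y] /=.
    by move=> [k _ [/= Fx Gy]]; split; exists k.
  move=> [[k _ Fx] [l _ Gy]]; exists (maxn k l) => //; split => /=.
  - by move: x Fx; exact/subsetPset/ndF/leq_maxl.
  - by move: y Gy; exact/subsetPset/ndG/leq_maxr.
move=> k; have [mFk Fkoo] := Foo k; have [mGk Gkoo] := Goo k; split.
  rewrite -[X in measurable X]setTI; apply: measurable_rV_uncons => //.
  exact: measurableX.
rewrite /lebesgue_rV_step /pushforward -comp_preimage.
rewrite (_ : @rV_uncons n \o @rV_cons n = id); last first.
  by apply/funext => p; exact: rV_consK.
rewrite preimage_id product_measure1E// lte_mul_pinfty//.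
by rewrite ge0_fin_numE.
Qed.

HB.instance Definition _ := @Measure_isSigmaFinite.Build _ _ _ lebesgue_rV_step
  step_sigma_finite.

End step.

(* d-dimensional Lebesgue measure: the d-fold product of lebesgue_measure,
   transported to row vectors. *)
Fixpoint lebesgue_rV (n : nat) : {sigma_finite_measure set 'rV[R]_n -> \bar R} :=
  match n with
  | 0 => \d_(0 : 'rV[R]_0)
  | n'.+1 => lebesgue_rV_step (lebesgue_rV n')
  end.

Lemma lebesgue_rV_box n (A : 'I_n -> set R) : (forall i, measurable (A i)) ->
  lebesgue_rV n [set x | forall i, A i (x 0 i)] = (\prod_(i < n) lebesgue_measure (A i))%E.
Proof.
elim: n A => [|n IH] A mA.
  rewrite big_ord0 /= diracE mem_set//; by move=> i; have := ltn_ord i; rewrite ltn0.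
have mB : measurable [set y : 'rV[R]_n | forall j, A (lift ord0 j) (y 0 j)].
  have -> : [set y : 'rV[R]_n | forall j, A (lift ord0 j) (y 0 j)] =
    \bigcap_(j in [set: 'I_n]) ((fun y : 'rV[R]_n => y 0 j) @^-1` A (lift ord0 j)).
    by apply/seteqP; split => y /= h i; [move=> _; exact: h|exact: h].
  apply: fin_bigcap_measurable => // j _.
  by rewrite -[X in measurable X]setTI; apply: measurable_coord.
rewrite big_ord_recl -(IH (fun j => A (lift ord0 j)))//.
rewrite /= /lebesgue_rV_step /pushforward -product_measure1E//; last exact: mA.
congr (_ _); apply/seteqP; split => -[a y] /=.
  move=> h; split => [|j]; first by have := h ord0; rewrite mxE unlift_none.
  by have := h (lift ord0 j); rewrite mxE liftK.
by move=> [Aa Ay] i; rewrite mxE; case: unliftP => [j ->|->].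
Qed.

End lebesgue_rV.

Section capacities.
Context {R : realType} {d : nat}.
Implicit Types (x y : 'rV[R]_d) (mu : {measure set 'rV[R]_d -> \bar R}).
Implicit Types (E : set 'rV[R]_d) (s r : R).

(* The norm `|x| of the library on 'rV[R]_d is the maximum norm. *)
Definition enorm x : R := Num.sqrt (\sum_(i < d) x 0 i ^+ 2).

Definition eball x r : set 'rV[R]_d := [set y | enorm (y - x) < r].

Definition radon mu : Prop :=
  (forall K : set 'rV[R]_d, compact K -> mu K < +oo)%E /\
  (forall A, measurable A ->
     mu A = ereal_sup [set mu K | K in [set K | compact K /\ K `<=` A]]).

Definition M_plus E : set {measure set 'rV[R]_d -> \bar R} :=
  [set mu | radon mu /\ mu (~` E) = 0%E].

Definition riesz_trunc s mu x (e : R) : 'rV[R]_d :=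
  \row_(i < d) \int[mu]_(y in [set y | e < enorm (y - x)])
    ((y - x) 0 i / enorm (y - x) `^ (s + 1)).

(* For mu in M_plus E, E compact and 0 < s < d, the limit exists for Lebesgue
   almost every x; elsewhere lim returns an arbitrary default. *)
Definition riesz s mu x : 'rV[R]_d := lim (riesz_trunc s mu x e @[e --> 0^'+]).

Definition riesz_Linfty s mu : \bar R :=
  Lnorm (lebesgue_rV d) +oo%E (fun x => (enorm (riesz s mu x))%:E).

Definition gamma_plus s E : \bar R :=
  ereal_sup [set mu setT | mu in M_plus E `&` [set mu | riesz_Linfty s mu <= 1]%E].

Local Open Scope ereal_scope.

Definition wolff s mu x : \bar R :=
  \int[lebesgue_measure]_(r in `]0%R, +oo[)
    ((mu (eball x r) / (r `^ s)%:E) ^+ 2 * (r^-1)%:E).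

Definition wolff_energy s mu : \bar R := \int[mu]_x wolff s mu x.

Definition wolff_term s mu : \bar R :=
  if wolff_energy s mu == +oo then 0
  else mu setT `^ (3 / 2) * wolff_energy s mu `^ (- (1 / 2)).

(* The element 0 makes the supremum 0 rather than -oo when E carries no
   nonzero measure; all the other elements are nonnegative. *)
Definition wolff_sup s E : \bar R :=
  ereal_sup (0 |` [set wolff_term s mu | mu in M_plus E `&` [set mu | mu setT != 0]]).

End capacities.

(* Main.v *)
Require Import Defs.
From HB Require Import structures.
From mathcomp Require Import all_boot all_order all_algebra.
From mathcomp Require Import all_classical all_reals all_analysis.
From mathcomp Require Import ring lra measurable_realfun.

Import Order.TTheory GRing.Theory Num.Theory.
Import numFieldTopology.Exports numFieldNormedType.Exports.

Local Open Scope classical_set_scope.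
Local Open Scope ring_scope.

(** Write R mu = K * mu with K(z) = z / |z|^(s+1).  Let mu have mass M and finite
energy W(mu), the integral of its Wolff potential.  Up to constants, the claim
is that some density h with values in [0,1] keeps a fixed part of M while
R (lam h mu) is bounded, for lam = (M / W(mu))^(1/2): the measure lam h mu has
mass comparable to M^(3/2) W(mu)^(-1/2).

Everything rests on symmetrization.  For three points x, y, z the sum of the
products K(x-y)K(x-z), K(y-x)K(y-z), K(z-x)K(z-y), taken coordinate by
coordinate, is at most a constant times
  (shortest side)^(b-s) * (longest side)^(-(s+b)),   b = min(1,s)
(rker_sym_le).  Integrated three times against mu, this weight is controlled by
W(mu), by comparing dyadic shells around a point (energy_le).  By
Chebyshev, the double integral V of the weight is at most a multiple of W(mu)/M
on a part of mu of mass M/2; rescaled by lam, V is at most 1 there.  Since the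
weight decreases with the distances, a nearest point argument bounds V by 4^s
in the whole space (potential_le), and V controls densities as well
(density_le).

Let w be this good part and sigma any finite positive measure.  Symmetrizing
with one point from sigma and two from a piece A of w bounds
  int |R w_A|^2 dsigma + 2 int_A (R sigma) . (R w_A) dw
by a multiple of |sigma|.  When A is a dyadic level set of a coordinate of
R sigma, with kernel read from sigma to w, this yields
  w (|R sigma| > t) <= C |sigma| / t
with no covering argument and no doubling condition (weak_type).  So for
each sigma some h keeping half of w satisfies <sigma, R (h w)> <= C |sigma|.
The passage from one h for each sigma to one h for all sigma is Blackwell's
approachability theorem: answering repeatedly to the current excess and
averaging the answers brings the excess to zero (approachability).

These steps are carried out for finitely many point masses, obtained from mu by
cutting its support into small cells, and finitely many test points (x, t), with
K replaced by K_t(z) = z / max(|z|, t)^(s+1).  The argument only uses that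
the truncated distances max(|x-y|, t) satisfy the triangle inequality, so tests
at different scales t may be mixed.  The conditions on h are linear
and indexed by countably many tests (rational x, dyadic t); densities of nearly
minimal L2 norm satisfying more and more of them converge almost everywhere to
one that satisfies them all (weak_compactness).  Finally the sharp truncations
at scale t differ from K_t by at most t^(-s) mu(B(x, 2t)), hence stay bounded,
and so does their limit wherever it exists; elsewhere the function riesz takes
the value 0. *)

(** * Symmetrization of the truncated kernel *)

Section kernel.
Variable R : realType.
Implicit Types (s b a c u v w l h x y p r t : R).

(** One coordinate of the Riesz kernel: u is a coordinate of a vector and a its
length, or a larger truncated length. *)
Definition rker s u a : R := u / a `^ (s + 1).

(** The bound for the symmetrized kernel on a triangle of sides a, c, e. *)
Definition triple_weight s b a c e : R :=
  Num.min a (Num.min c e) `^ (b - s) * Num.max a (Num.max c e) `^ (- (s + b)).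

Lemma ler_npowR p x y : p <= 0 -> 0 < x -> x <= y -> y `^ p <= x `^ p.
Proof.
move=> p0 x0 xy; have y0 : 0 < y by apply: lt_le_trans xy.
rewrite -[p]opprK powRN (powRN x) lef_pV2 ?posrE ?powR_gt0//.
by apply: ge0_ler_powR; rewrite ?nnegrE ?oppr_ge0 ?(ltW x0) ?(ltW y0).
Qed.

Lemma powR_gt0D x r t : 0 < x -> x `^ (r + t) = x `^ r * x `^ t.
Proof. by move=> x0; rewrite powRD//; apply/implyP => _; rewrite gt_eqF. Qed.

(** Replacing the real exponent by a larger integer turns the mean value
inequality for powers into the factorization of 1 - x^n. *)
Lemma one_sub_powR_le (n : nat) p x : 0 < x <= 1 -> p <= n%:R ->
  1 - x `^ p <= n%:R * (1 - x).
Proof.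
move=> /andP[x0 x1] pn.
apply: (@le_trans _ _ (1 - x ^+ n)).
  rewrite lerD2l lerN2 -powR_mulrn ?(ltW x0)//.
  by apply: (ger_powR _ pn); rewrite x0.
elim: n {pn} => [|n IH]; first by rewrite expr0 subrr mul0r.
rewrite exprS -natr1.
have xn : x ^+ n <= 1 by rewrite exprn_ile1 ?(ltW x0).
have xn0 : 0 <= x ^+ n by rewrite exprn_ge0// ltW.
nra.
Qed.

(** The larger length is attached to y, whose size it bounds; this turns the
difference of the two denominators into a Bernoulli-type estimate. *)
Lemma rker_diff (n : nat) s x y l h : 0 < l -> l <= h -> 0 < s -> s + 1 <= n%:R ->
  `|y| <= h ->
  `|rker s x l - rker s y h| <= (`|x - y| + n%:R * (h - l)) * l `^ (- (s + 1)).
Proof.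
move=> l0 lh s0 sn yh; have h0 : 0 < h by apply: lt_le_trans lh.
have P0 : 0 < l `^ (- (s + 1)) by rewrite powR_gt0.
have hl : h `^ (- (s + 1)) <= l `^ (- (s + 1)).
  by apply: ler_npowR => //; rewrite oppr_le0 addr_ge0// ltW.
rewrite /rker -!powRN.
have -> : x * l `^ (- (s + 1)) - y * h `^ (- (s + 1)) =
  (x - y) * l `^ (- (s + 1)) + y * (l `^ (- (s + 1)) - h `^ (- (s + 1))) by ring.
apply: (le_trans (ler_normD _ _)); rewrite !normrM mulrDl lerD//.
  by rewrite (ger0_norm (ltW P0)).
rewrite [X in _ * X]ger0_norm ?subr_ge0//.
apply: (@le_trans _ _ (h * (l `^ (- (s + 1)) - h `^ (- (s + 1))))).
  by rewrite ler_wpM2r// subr_ge0.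
have -> : h `^ (- (s + 1)) = l `^ (- (s + 1)) * (l / h) `^ (s + 1).
  rewrite powRM ?invr_ge0 ?ltW// mulrA -powR_gt0D// addNr powRr0 mul1r.
  by rewrite -powR_inv1 ?ltW// -powRrM mulN1r.
have /(one_sub_powR_le _ (s+1) _)-/(_ n sn) H : 0 < l / h <= 1.
  by rewrite divr_gt0// ler_pdivrMr// mul1r.
have -> : h * (l `^ (- (s + 1)) - l `^ (- (s + 1)) * (l / h) `^ (s + 1)) =
  (h * (1 - (l / h) `^ (s + 1))) * l `^ (- (s + 1)) by ring.
rewrite ler_wpM2r ?(ltW P0)//.
apply: (le_trans (ler_wpM2l (ltW h0) H)).
rewrite le_eqVlt; apply/orP; left; apply/eqP; field; exact: lt0r_neq0.
Qed.

Lemma rker_norm s u a : 0 < a -> `|u| <= a -> `|rker s u a| <= a `^ (- s).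
Proof.
move=> a0 ua; rewrite /rker -powRN normrM (ger0_norm (powR_ge0 _ _)).
apply: (le_trans (ler_wpM2r (powR_ge0 _ _) ua)).
rewrite -{1}(powRr1 (ltW a0)) -powR_gt0D//.
by rewrite opprD addrCA subrr addr0.
Qed.

(** The heart of the symmetrization: when x is the shortest side, the two terms
with a factor of size x^(-s) combine into a difference of kernels at
neighbouring points, which gains a factor x / l. *)
Lemma rker_sym_shortest (n : nat) s b x l h u v w y : 0 < x -> x <= l -> l <= h -> h <= x + l ->
  0 < b -> b <= 1 -> b <= s -> s + 1 <= n%:R ->
  `|u| <= x -> `|v| <= l -> `|w| <= h -> `|v - w| <= x -> `|y| <= l `^ (- s) * h `^ (- s) ->
  `|rker s u x * (rker s v l - rker s w h) + y| <=
   (n.+2%:R * 4 `^ s) * (x `^ (b - s) * h `^ (- (s + b))).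
Proof.
move=> x0 xl lh hxl b0 b1 bs sn ux vl wh vwx yl.
have l0 : 0 < l by apply: lt_le_trans xl.
have h0 : 0 < h by apply: lt_le_trans lh.
have s0 : 0 < s by apply: lt_le_trans bs.
set X := x `^ (b - s) * l `^ (- (s + b)).
have H1 : x `^ (- s) * (x * l `^ (- (s + 1))) <= X.
  have -> : x `^ (- s) * (x * l `^ (- (s + 1))) = x `^ (b - s) * (x `^ (1 - b) * l `^ (- (s + 1))).
    rewrite mulrA -[X in _ * X * _](powRr1 (ltW x0)) -powR_gt0D// mulrA -powR_gt0D//.
    by congr (_ `^ _ * _); ring.
  apply: ler_wpM2l; first exact: powR_ge0.
  have -> : - (s + b) = (1 - b) - (s + 1) by ring.
  rewrite (powR_gt0D l (1 - b))// ler_wpM2r ?powR_ge0//.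
  by apply: ge0_ler_powR; rewrite ?nnegrE ?subr_ge0 ?(ltW x0) ?(ltW l0).
have H2 : l `^ (- s) * h `^ (- s) <= X.
  apply: (@le_trans _ _ (l `^ (- s) * l `^ (- s))).
    by rewrite ler_wpM2l ?powR_ge0// ler_npowR// oppr_le0 ltW.
  rewrite -powR_gt0D// /X.
  have -> : - s - s = (b - s) - (s + b) by ring.
  rewrite powR_gt0D// ler_wpM2r ?powR_ge0// ler_npowR//.
  by rewrite subr_le0.
have H3 : X <= 4 `^ s * (x `^ (b - s) * h `^ (- (s + b))).
  rewrite mulrCA ler_wpM2l ?powR_ge0//.
  apply: (@le_trans _ _ (4 `^ s * (2 * l) `^ (- (s + b)))); last first.
    rewrite ler_wpM2l ?powR_ge0// ler_npowR//; last by lra.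
    by rewrite oppr_le0 addr_ge0// ltW.
  rewrite powRM ?(ltW l0)// mulrA -[leLHS]mul1r ler_wpM2r ?powR_ge0//.
  have -> : 4 = 2 * 2 :> R by ring.
  rewrite powRM// -powR_gt0D// -powR_gt0D// -[leLHS](powRr0 2).
  by apply: ler_powR; lra.
have D := rker_diff n s v w l h l0 lh s0 sn wh.
have K := rker_norm s u x x0 ux.
apply: (le_trans (ler_normD _ _)); rewrite normrM.
apply: (@le_trans _ _ (n.+1%:R * X + X)); last first.
  have -> : n.+1%:R * X + X = n.+2%:R * X by rewrite -[n.+2%:R]natr1; ring.
  by rewrite -mulrA ler_wpM2l.
apply: lerD; last exact: le_trans H2.
apply: (@le_trans _ _ (x `^ (- s) * ((x + n%:R * x) * l `^ (- (s + 1))))).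
  apply: ler_pM => //; apply: (le_trans D).
  rewrite ler_wpM2r ?powR_ge0// lerD// ler_wpM2l//; lra.
have -> : x `^ (- s) * ((x + n%:R * x) * l `^ (- (s + 1))) =
  n.+1%:R * (x `^ (- s) * (x * l `^ (- (s + 1)))) by rewrite -natr1; ring.
by rewrite ler_wpM2l.
Qed.

Lemma rkerN s u a : rker s (- u) a = - rker s u a.
Proof. by rewrite /rker mulNr. Qed.

(** The symmetrized sum changes by signs only when the vertices are permuted, so
each ordering of the three sides reduces to the case of a shortest first side. *)
Lemma rker_sym_le (n : nat) s b u v w x y z :
  0 < b -> b <= 1 -> b <= s -> s + 1 <= n%:R ->
  0 < x -> 0 < y -> 0 < z -> x <= y + z -> y <= x + z -> z <= x + y ->
  `|u| <= x -> `|v| <= y -> `|w| <= z -> v = u + w ->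
  rker s u x * rker s v y - rker s u x * rker s w z + rker s v y * rker s w z <=
    (n.+2%:R * 4 `^ s) * triple_weight s b x y z.
Proof.
move=> b0 b1 bs sn x0 y0 z0 xyz yxz zxy ux vy wz vuw.
have pr r t : 0 < r -> 0 < t -> forall p q : R, `|p| <= r -> `|q| <= t ->
    `|rker s p r * rker s q t| <= r `^ (- s) * t `^ (- s).
  move=> r0 t0 p q pr qt; rewrite normrM ler_pM//; exact: rker_norm.
apply: (le_trans (ler_norm _)); rewrite /triple_weight.
have [xy|/ltW yx] := leP x y; have [yz|/ltW zy] := leP y z.
- rewrite (min_l xy) (max_r (le_trans xy yz)).
  rewrite -mulrBr; apply: rker_sym_shortest => //; last exact: pr.
  by rewrite vuw addrK.
- have [xz|/ltW zx] := leP x z.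
    rewrite (max_r xy).
    rewrite -mulrBr -normrN opprD -mulrN opprB.
    apply: rker_sym_shortest => //; try lra; [by rewrite vuw opprD addrCA subrr addr0 normrN|].
    by rewrite normrN mulrC; exact: pr.
  rewrite (max_r xy).
  have -> : rker s u x * rker s v y - rker s u x * rker s w z + rker s v y * rker s w z =
    - (rker s w z * (rker s u x - rker s v y) + - (rker s u x * rker s v y)) by ring.
  rewrite normrN; apply: rker_sym_shortest => //; try lra; [by rewrite vuw opprD addNKr normrN|].
  by rewrite normrN; exact: pr.
- have [xz|/ltW zx] := leP x z.
    rewrite (min_r yx).
    rewrite -[X in X * _ - _]opprK -rkerN.
    have -> : - rker s (- u) x * rker s v y - rker s u x * rker s w z + rker s v y * rker s w z =
      - (rker s v y * (rker s (- u) x - rker s w z) + - ( rker s (- u) x * rker s w z)).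
      rewrite !rkerN; ring.
    rewrite normrN; apply: rker_sym_shortest => //; rewrite ?normrN//; try lra.
      by rewrite -opprD normrN -vuw.
    by apply: pr; rewrite ?normrN.
  rewrite (min_r yx).
  have -> : rker s u x * rker s v y - rker s u x * rker s w z + rker s v y * rker s w z =
      (rker s v y * (rker s w z - rker s (- u) x) + - (rker s w z * rker s u x)).
    rewrite !rkerN; ring.
  apply: rker_sym_shortest => //; rewrite ?normrN//; try lra; [by rewrite opprK addrC -vuw|].
  exact: pr.
- (* z <= y <= x *)
  rewrite (min_r (le_trans zy yx)) (max_l yx).
  have -> : rker s u x * rker s v y - rker s u x * rker s w z + rker s v y * rker s w z =
      (rker s w z * (rker s v y - rker s u x) + (rker s v y * rker s u x)) by ring.
  apply: rker_sym_shortest => //; try lra; [by rewrite vuw addrC addKr|exact: pr].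
Qed.

End kernel.

(** * The weak-type inequality for finite systems of masses *)

Section weak_type.
Variables (R : realType).

Lemma sum_sqr_le (J : finType) (c g : J -> R) : (forall j, 0 <= c j) ->
  (\sum_j c j * g j) ^+ 2 <= (\sum_j c j) * \sum_j c j * g j ^+ 2.
Proof.
move=> c0; set S := \sum_j c j; set P := \sum_j c j * g j.
set Q := \sum_j c j * g j ^+ 2.
have S0 : 0 <= S by apply: sumr_ge0.
have H : 0 <= \sum_j c j * (S * g j - P) ^+ 2.
  by apply: sumr_ge0 => j _; rewrite mulr_ge0// sqr_ge0.
have E : \sum_j c j * (S * g j - P) ^+ 2 = S ^+ 2 * Q - 2 * S * P * P + P ^+ 2 * S.
  transitivity (\sum_j (S ^+ 2 * (c j * g j ^+ 2) - 2 * S * P * (c j * g j) + P ^+ 2 * c j)).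
    by apply: eq_bigr => j _; ring.
  by rewrite big_split sumrB/= -!mulr_sumr.
have [S1|S1] := ltP 0 S.
  rewrite -subr_ge0 -(pmulr_rge0 _ S1).
  by apply: (le_trans H); rewrite E le_eqVlt; apply/orP; left; apply/eqP; ring.
have S2 : S = 0 by apply/le_anti; rewrite S1.
have c1 j : c j = 0.
  by move/eqP : S2; rewrite psumr_eq0// => /allP/(_ j); rewrite mem_index_enum => /(_ isT)/eqP.
by rewrite /P S2 mul0r big1 ?expr0n// => j _; rewrite c1 mul0r.
Qed.

Section symmetrization.
Variables (I : finType) (k : I -> I -> R) (u : I -> R).
Hypothesis kN : forall i j, k j i = - k i j.

(** Each of the three products has the same total sum: the vertices are permuted
and k is odd. *)
Lemma sum_square_symmetrization : 3 * \sum_i u i * (\sum_j u j * k i j) ^+ 2 =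
  \sum_i \sum_j \sum_l u i * u j * u l * (k i j * k i l - k i j * k j l + k i l * k j l).
Proof.
have E : \sum_i u i * (\sum_j u j * k i j) ^+ 2 =
    \sum_i \sum_j \sum_l u i * u j * u l * (k i j * k i l).
  apply: eq_bigr => i _; rewrite expr2 mulr_suml mulr_sumr; apply: eq_bigr => j _.
  by rewrite !mulr_sumr; apply: eq_bigr => l _; ring.
have E2 : \sum_i u i * (\sum_j u j * k i j) ^+ 2 =
    \sum_i \sum_j \sum_l u i * u j * u l * (- (k i j * k j l)).
  rewrite E exchange_big/=; apply: eq_bigr => i _; apply: eq_bigr => j _.
  by apply: eq_bigr => l _; rewrite (kN i j); ring.
have E3 : \sum_i u i * (\sum_j u j * k i j) ^+ 2 =
    \sum_i \sum_j \sum_l u i * u j * u l * (k i l * k j l).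
  rewrite E exchange_big/=.
  under eq_bigr do rewrite exchange_big/=.
  rewrite exchange_big/= [RHS]exchange_big/=; apply: eq_bigr => i _.
  apply: eq_bigr => j _; apply: eq_bigr => l _.
  by rewrite (kN j l) (kN i l); ring.
rewrite (_ : 3 = 1 + 1 + 1); last by ring.
rewrite !mulrDl !mul1r {1}E {1}E2 E3 -!big_split/=; apply: eq_bigr => i _.
rewrite -!big_split/=; apply: eq_bigr => j _.
by rewrite -!big_split/=; apply: eq_bigr => l _; ring.
Qed.

Variables (J : finType) (l : J -> I -> R) (c : J -> R).

(** One vertex is a test point j, of weight c, the other two are masses; the two
products based at a mass have equal sums, whence the factor 2. *)
Lemma sum_square_mixed_symmetrization :
  \sum_j c j * (\sum_i u i * l j i) ^+ 2 =
  \sum_j \sum_i \sum_h c j * u i * u h * (l j i * l j h - l j i * k i h + l j h * k i h)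
  + 2 * \sum_i u i * (\sum_j c j * l j i) * (\sum_h u h * k i h).
Proof.
pose A := \sum_i \sum_j \sum_h c j * u i * u h * (l j i * k i h).
have EA : \sum_i u i * (\sum_j c j * l j i) * (\sum_h u h * k i h) = A.
  apply: eq_bigr => i _; rewrite -mulrA mulr_suml mulr_sumr; apply: eq_bigr => j _.
  by rewrite !mulr_sumr; apply: eq_bigr => h _; ring.
rewrite EA (_ : 2 * A = A - (- A)); last by ring.
have EA1 : A = \sum_j \sum_i \sum_h c j * u i * u h * (l j i * k i h).
  by rewrite /A exchange_big.
have EA2 : - A = \sum_j \sum_i \sum_h c j * u i * u h * (l j h * k i h).
  rewrite EA1 -sumrN; apply: eq_bigr => j _.
  rewrite [RHS]exchange_big/= -sumrN; apply: eq_bigr => i _; rewrite -sumrN.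
  by apply: eq_bigr => h _; rewrite (kN h i); ring.
rewrite EA2 EA1 -sumrB -big_split/=; apply: eq_bigr => j _.
rewrite -sumrB -big_split/= expr2 mulr_suml mulr_sumr; apply: eq_bigr => i _.
rewrite -sumrB -big_split/= !mulr_sumr; apply: eq_bigr => h _; ring.
Qed.

End symmetrization.

Section weak_type_estimate.
Variables (I J : finType) (k : I -> I -> R) (l : J -> I -> R) (w : I -> R).
Variables (c : J -> R) (q : I -> I -> I -> R) (q' : J -> I -> I -> R) (B : R).
Hypotheses (kN : forall i j, k j i = - k i j) (w0 : forall i, 0 <= w i)
  (c0 : forall j, 0 <= c j) (B0 : 0 <= B)
  (q0 : forall i j h, 0 <= q i j h) (q'0 : forall i j h, 0 <= q' i j h)
  (kq : forall i j h, k i j * k i h - k i j * k j h + k i h * k j h <= q i j h)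
  (lq : forall j i h, l j i * l j h - l j i * k i h + l j h * k i h <= q' j i h)
  (wq : forall i, 0 < w i -> \sum_j \sum_h w j * w h * q i j h <= B)
  (wq' : forall j, \sum_i \sum_h w i * w h * q' j i h <= B).

Let f i := \sum_j c j * l j i.

Lemma sum_square_le u : (forall i, 0 <= u i <= w i) ->
  \sum_i u i * (\sum_j u j * k i j) ^+ 2 <= B * \sum_i u i.
Proof.
move=> uw; have u0 i : 0 <= u i by have /andP[] := uw i.
have uw1 i : u i <= w i by have /andP[] := uw i.
rewrite (@le_trans _ _ (3 * \sum_i u i * (\sum_j u j * k i j) ^+ 2))//.
  rewrite ler_peMl ?sumr_ge0//; first by move=> i _; rewrite mulr_ge0// sqr_ge0.
  by rewrite ler1n.
rewrite sum_square_symmetrization// mulr_sumr; apply: ler_sum => i _.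
have [ui|ui] := eqVneq (u i) 0.
  rewrite ui mulr0 big1// => j _; rewrite big1// => h _; by rewrite !mul0r.
apply: (@le_trans _ _ (u i * \sum_j \sum_h w j * w h * q i j h)).
  rewrite mulr_sumr; apply: ler_sum => j _.
  rewrite mulr_sumr; apply: ler_sum => h _.
  rewrite -!mulrA ler_wpM2l// !mulrA.
  apply: (@le_trans _ _ (u j * u h * q i j h)); first by rewrite ler_wpM2l// mulr_ge0.
  by rewrite ler_wpM2r// ler_pM.
rewrite mulrC ler_wpM2r// wq//; apply: lt_le_trans (uw1 i).
by rewrite lt_neqAle eq_sym ui u0.
Qed.

Lemma mixed_square_le u : (forall i, 0 <= u i <= w i) ->
  \sum_j c j * (\sum_i u i * l j i) ^+ 2 <=
  B * \sum_j c j + 2 * \sum_i u i * f i * (\sum_h u h * k i h).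
Proof.
move=> uw; have u0 i : 0 <= u i by have /andP[] := uw i.
have uw1 i : u i <= w i by have /andP[] := uw i.
rewrite (sum_square_mixed_symmetrization _ k)// lerD2r mulr_sumr; apply: ler_sum => j _.
apply: (@le_trans _ _ (c j * \sum_i \sum_h w i * w h * q' j i h)); last first.
  by rewrite mulrC ler_wpM2r.
rewrite mulr_sumr; apply: ler_sum => i _.
rewrite mulr_sumr; apply: ler_sum => h _.
rewrite -!mulrA ler_wpM2l// !mulrA.
apply: (@le_trans _ _ (u i * u h * q' j i h)); first by rewrite ler_wpM2l// mulr_ge0.
by rewrite ler_wpM2r// ler_pM.
Qed.

(** On the level set A, the inner product of w_A with the field f is at least
t w(A), and moving the kernel to the other side bounds it by the L2 norm over
the test points of the potential of w_A.  Mixed symmetrization controls that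
norm, up to a term at most a multiple of t w(A) because f <= 2 t on A. *)
Lemma dyadic_level_le t : 0 < t ->
  t * \sum_(i | t < f i <= 2 * t) w i <= (4 + 2 * B) * \sum_j c j.
Proof.
move=> t0; pose A := [pred i | t < f i <= 2 * t].
pose u i := if A i then w i else 0.
have uw i : 0 <= u i <= w i by rewrite /u; case: ifP => _; rewrite ?lexx w0.
have u0 i : 0 <= u i by have /andP[] := uw i.
have -> : \sum_(i | t < f i <= 2 * t) w i = \sum_i u i by rewrite -big_mkcond.
set S := \sum_j c j; set X := t * \sum_i u i.
have S0 : 0 <= S by apply: sumr_ge0.
have X0 : 0 <= X by rewrite mulr_ge0 ?(ltW t0)// sumr_ge0.
have H1 : X <= \sum_j c j * \sum_i u i * l j i.
  have -> : \sum_j c j * (\sum_i u i * l j i) = \sum_i u i * f i.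
    under eq_bigr do rewrite mulr_sumr.
    rewrite exchange_big/=; apply: eq_bigr => i _; rewrite mulr_sumr.
    by apply: eq_bigr => j _; ring.
  rewrite /X mulr_sumr; apply: ler_sum => i _; rewrite mulrC /u.
  by case: ifP => [/andP[ti _]|]; [rewrite ler_wpM2l// ltW|rewrite !mul0r].
have H2 := sum_sqr_le _ c (fun j => \sum_i u i * l j i) c0.
have H3 := mixed_square_le u uw.
have H4 := sum_square_le u uw.
have H5 : 2 * \sum_i u i * f i * (\sum_h u h * k i h) <= (4 + B) * X.
  have : 2 * \sum_i u i * f i * (\sum_h u h * k i h) <=
      \sum_i (t * 4 * u i + t * (u i * (\sum_h u h * k i h) ^+ 2)).
    rewrite mulr_sumr; apply: ler_sum => i _; set r := \sum_h _.
    rewrite /u; case: ifP => [/andP[fi1 fi2]|_]; last by rewrite !(mul0r,mulr0) addr0.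
    have -> : t * 4 * w i + t * (w i * r ^+ 2) = w i * (t * 4 + t * r ^+ 2) by ring.
    have -> : 2 * (w i * f i * r) = w i * (2 * (f i * r)) by ring.
    rewrite ler_wpM2l//.
    apply: (@le_trans _ _ (f i ^+ 2 / t + t * r ^+ 2)).
      rewrite -subr_ge0.
      have -> : f i ^+ 2 / t + t * r ^+ 2 - 2 * (f i * r) = (f i - t * r) ^+ 2 / t.
        by field; rewrite gt_eqF.
      by rewrite divr_ge0 ?sqr_ge0 ?(ltW t0).
    rewrite lerD2r ler_pdivrMr//.
    have -> : t * 4 * t = (2 * t) ^+ 2 by ring.
    by rewrite ler_sqr// ?nnegrE; lra.
  move=> /le_trans; apply; rewrite big_split/= -!mulr_sumr.
  apply: (@le_trans _ _ (t * 4 * \sum_i u i + t * (B * \sum_i u i))).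
    by rewrite lerD2l ler_wpM2l// ltW.
  by rewrite /X le_eqVlt; apply/orP; left; apply/eqP; ring.
have H6 : X ^+ 2 <= S * (B * S + (4 + B) * X).
  apply: (@le_trans _ _ ((\sum_j c j * \sum_i u i * l j i) ^+ 2)).
    by rewrite ler_sqr// nnegrE; apply: le_trans H1.
  apply: (le_trans H2); rewrite ler_wpM2l//; apply: (le_trans H3).
  by rewrite lerD2l.
(* H6 is quadratic in X, so X cannot exceed a multiple of S. *)
rewrite leNgt; apply/negP => H7.
have B1 : 1 <= 4 + 2 * B by have := B0; lra.
have SX : S <= X by apply: le_trans (ltW H7); rewrite ler_peMl.
have : S * (B * S + (4 + B) * X) <= (4 + 2 * B) * S * X.
  have : B * S * S <= B * S * X by rewrite ler_wpM2l// mulr_ge0.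
  nra.
have : (4 + 2 * B) * S * X < X ^+ 2.
  rewrite expr2 ltr_pM2r//; apply: le_lt_trans H7; rewrite mulr_ge0//; exact: le_trans ler01 B1.
lra.
Qed.

(** The dyadic levels 2^n t, n >= 0, contribute a geometric series; only finitely
many of them are populated. *)
Lemma one_sided_weak_type t : 0 < t ->
  t * \sum_(i | t < f i) w i <= 2 * (4 + 2 * B) * \sum_j c j.
Proof.
move=> t0; set D := (4 + 2 * B) * \sum_j c j.
have D0 : 0 <= D by rewrite mulr_ge0 ?sumr_ge0//; have := B0; lra.
have H n r : 0 < r -> r * \sum_(i | r < f i) w i <=
    2 * D + r * \sum_(i | 2 ^+ n * r < f i) w i.
  elim: n r => [|n IH] r r0; first by rewrite expr0 mul1r; lra.
  have -> : \sum_(i | r < f i) w i = \sum_(i | r < f i <= 2 * r) w i + \sum_(i | 2 * r < f i) w i.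
    rewrite (bigID (fun i => f i <= 2 * r))/=; congr (_ + _).
    apply: eq_bigl => i; rewrite -ltNge andb_idl// => /(lt_trans _); apply; lra.
  have r2 : 0 < 2 * r by lra.
  have := IH _ r2; have := dyadic_level_le r r0; rewrite -/D.
  rewrite mulrA -exprSr.
  set a := \sum_(_ | _) _; set b := \sum_(_ | _) _; set e := \sum_(_ | _) _; lra.
pose M := \sum_i `|f i|.
have [n nM] : exists n : nat, M / t <= 2 ^+ n.
  exists (Num.bound (M / t)).
  apply: (@le_trans _ _ (Num.bound (M / t))%:R).
    by rewrite ltW// archi_boundP// divr_ge0 ?(ltW t0)// sumr_ge0.
  by rewrite -natrX ler_nat ltnW// ltn_expl.
apply: (le_trans (H n t t0)); rewrite big_pred0 ?mulr0 ?addr0 ?mulrA// => i.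
apply/negbTE; rewrite -leNgt.
apply: (@le_trans _ _ M); last by rewrite -ler_pdivrMr.
apply: (le_trans (ler_norm _)); rewrite /M (bigD1 i)//= lerDl.
by rewrite sumr_ge0.
Qed.

End weak_type_estimate.

(** The lower half of the level set is handled by changing the sign of both
kernels. *)
Lemma weak_type (I J : finType) (k : I -> I -> R) (l : J -> I -> R) (w : I -> R)
  (c : J -> R) (q : I -> I -> I -> R) (q' : J -> I -> I -> R) (B : R) :
  (forall i j, k j i = - k i j) -> (forall i, 0 <= w i) ->
  (forall j, 0 <= c j) -> 0 <= B ->
  (forall i j h, 0 <= q i j h) -> (forall i j h, 0 <= q' i j h) ->
  (forall i j h, k i j * k i h - k i j * k j h + k i h * k j h <= q i j h) ->
  (forall j i h, l j i * l j h - l j i * k i h + l j h * k i h <= q' j i h) ->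
  (forall i, 0 < w i -> \sum_j \sum_h w j * w h * q i j h <= B) ->
  (forall j, \sum_i \sum_h w i * w h * q' j i h <= B) ->
  forall t, 0 < t ->
  t * \sum_(i | t < `|\sum_j c j * l j i|) w i <= 4 * (4 + 2 * B) * \sum_j c j.
Proof.
move=> kN w0 c0 B0 q0 q'0 kq lq wq wq' t t0.
have H1 := one_sided_weak_type I J k l w c q q' B kN w0 c0 B0 q0 q'0 kq lq wq wq' t t0.
have H2 : t * \sum_(i | t < - \sum_j c j * l j i) w i <= 2 * (4 + 2 * B) * \sum_j c j.
  under eq_bigl do (rewrite -sumrN; under eq_bigr do rewrite -mulrN).
  apply: (one_sided_weak_type I J (fun i j => - k i j) (fun j i => - l j i) w c q q' B) => //.
  - by move=> i j; rewrite kN.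
  - by move=> i j h; rewrite !mulrNN.
  - by move=> i j h; rewrite !mulrNN.
have H3 : \sum_(i | t < `|\sum_j c j * l j i|) w i <=
  \sum_(i | t < \sum_j c j * l j i) w i + \sum_(i | t < - \sum_j c j * l j i) w i.
  rewrite big_mkcond [X in _ <= X + _]big_mkcond [X in _ <= _ + X]big_mkcond/=.
  rewrite -big_split/=; apply: ler_sum => i _; rewrite lter_normr/=.
  by case: ltP => _ /=; [rewrite lerDl; case: ifP => // _; exact: w0|case: ifP => _; rewrite add0r].
apply: (le_trans (ler_wpM2l (ltW t0) H3)); rewrite mulrDr.
apply: (le_trans (lerD H1 H2)); lra.
Qed.

End weak_type.

(** * From one density for each test measure to one density for all *)

Section approachability.
Variables (R : realType) (T I : finType) (a : T -> I -> R).
Variables (H : (I -> R) -> Prop) (C D : R).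
Hypotheses (H0 : exists h, H h)
  (Hconvex : forall h h' t, H h -> H h' -> 0 <= t <= 1 ->
    H (fun i => (1 - t) * h i + t * h' i))
  (Hbounded : forall h, H h -> \sum_x (\sum_i a x i * h i - C) ^+ 2 <= D)
  (Hresponse : forall c : T -> R, (forall x, 0 <= c x) ->
    exists2 h, H h & \sum_x c x * \sum_i a x i * h i <= C * \sum_x c x).

(** Blackwell's argument: answering to the excess g of the current average over
the target C, the squared excess of the average of n answers is at most D / n,
since the cross term in the square is nonpositive. *)
Lemma approachability e : 0 < e -> exists2 h, H h & forall x, \sum_i a x i * h i <= C + e.
Proof.
move=> e0.
pose v h x := \sum_i a x i * h i.
pose g h x := Num.max 0 (v h x - C).
have D0 : 0 <= D.
  have [h Hh] := H0; apply: le_trans (Hbounded h Hh).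
  by apply: sumr_ge0 => x _; exact: sqr_ge0.
have step n : exists2 h, H h & \sum_x g h x ^+ 2 <= D / n.+1%:R.
  elim: n => [|n [h Hh hD]].
    have [h Hh] := H0; exists h => //; rewrite divr1.
    apply: le_trans (Hbounded h Hh); apply: ler_sum => x _; rewrite /g /v.
    by case: (leP 0) => _; rewrite ?lexx// expr0n/= sqr_ge0.
  have [h' Hh' hh'] := Hresponse (g h) (fun x => ltac:(by rewrite /g le_max lexx)).
  pose t : R := n.+2%:R^-1.
  have n0 : (0 : R) < n.+1%:R by rewrite ltr0n.
  have n1 : (0 : R) < n.+1%:R + 1 by rewrite addr_gt0.
  have t01 : 0 <= t <= 1 by rewrite /t invr_ge0 ler0n/= invf_le1 ?ltr0n// ler1n.
  exists (fun i => (1 - t) * h i + t * h' i); first exact: Hconvex.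
  have vE x : v (fun i => (1 - t) * h i + t * h' i) x = (1 - t) * v h x + t * v h' x.
    by rewrite /v !mulr_sumr -big_split/=; apply: eq_bigr => i _; ring.
  have E1 : (1 - t) = n.+1%:R * t.
    by rewrite /t -[n.+2%:R]natr1; field; exact: lt0r_neq0.
  apply: (@le_trans _ _ (\sum_x (t ^+ 2 * (n.+1%:R ^+ 2 * g h x ^+ 2) +
      t ^+ 2 * (2 * n.+1%:R * (g h x * (v h' x - C))) + t ^+ 2 * (v h' x - C) ^+ 2))).
    apply: ler_sum => x _.
    have -> : t ^+ 2 * (n.+1%:R ^+ 2 * g h x ^+ 2) +
      t ^+ 2 * (2 * n.+1%:R * (g h x * (v h' x - C))) + t ^+ 2 * (v h' x - C) ^+ 2 =
      ((1 - t) * g h x + t * (v h' x - C)) ^+ 2 by rewrite E1; ring.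
    rewrite {1}/g vE; case: (leP 0) => [le0|_]; last by rewrite expr0n/= sqr_ge0.
    have H1 : v h x - C <= g h x by rewrite /g le_max lexx orbT.
    have H2 : (1 - t) * (v h x - C) <= (1 - t) * g h x.
      by rewrite ler_wpM2l// subr_ge0; case/andP: t01.
    rewrite ler_sqr ?nnegrE//; lra.
  rewrite !big_split/= -!mulr_sumr -!mulrDr.
  have H1 : \sum_x g h x * (v h' x - C) <= 0.
    under eq_bigr do rewrite mulrBr.
    by rewrite sumrB subr_le0 -mulr_suml [leRHS]mulrC; exact: hh'.
  have H2 : n.+1%:R ^+ 2 * \sum_x g h x ^+ 2 <= n.+1%:R * D.
    rewrite expr2 -mulrA ler_wpM2l ?(ltW n0)//.
    by move: hD; rewrite ler_pdivlMr// [leLHS]mulrC.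
  have H3 := Hbounded h' Hh'; rewrite -/(v h') in H3.
  apply: (@le_trans _ _ (t ^+ 2 * (n.+1%:R * D + D))); last first.
    rewrite /t -[n.+2%:R]natr1 le_eqVlt; apply/orP; left; apply/eqP; field.
    exact: lt0r_neq0.
  rewrite ler_wpM2l ?sqr_ge0//.
  have : 2 * n.+1%:R * \sum_x g h x * (v h' x - C) <= 0.
    by apply: mulr_ge0_le0 => //; rewrite mulr_ge0.
  rewrite -/(v h') in H3 *; lra.
have [n nD] : exists n : nat, D / n.+1%:R <= e ^+ 2.
  exists (Num.bound (D / e ^+ 2)).
  rewrite ler_pdivrMr ?ltr0n// mulrC -ler_pdivrMr ?exprn_gt0//.
  apply: (@le_trans _ _ (Num.bound (D / e ^+ 2))%:R); last by rewrite ler_nat.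
  by rewrite ltW// archi_boundP// divr_ge0// sqr_ge0.
have [h Hh hD] := step n; exists h => // x.
have : g h x ^+ 2 <= e ^+ 2.
  apply: le_trans (le_trans hD nD); rewrite (bigD1 x)//= lerDl.
  by apply: sumr_ge0 => y _; exact: sqr_ge0.
rewrite ler_sqr ?nnegrE ?(ltW e0)//; last by rewrite /g le_max lexx.
by rewrite /g ge_max => /andP[_]; rewrite -/(v h x); lra.
Qed.

End approachability.

Section finite_game.
Variables (R : realType) (P I J : finType).
Variables (k : P -> I -> I -> R) (l : P -> J -> I -> R) (w : I -> R).
Variables (q : I -> I -> I -> R) (q' : J -> I -> I -> R) (B : R).
Hypotheses (kN : forall p i j, k p j i = - k p i j) (w0 : forall i, 0 <= w i)
  (B0 : 0 <= B)
  (q0 : forall i j h, 0 <= q i j h) (q'0 : forall i j h, 0 <= q' i j h)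
  (kq : forall p i j h, k p i j * k p i h - k p i j * k p j h + k p i h * k p j h <= q i j h)
  (lq : forall p j i h, l p j i * l p j h - l p j i * k p i h + l p j h * k p i h <= q' j i h)
  (wq : forall i, 0 < w i -> \sum_j \sum_h w j * w h * q i j h <= B)
  (wq' : forall j, \sum_i \sum_h w i * w h * q' j i h <= B).

Let D := 4 * (4 + 2 * B).

Let H (h : I -> R) := (forall i, 0 <= h i <= 1) /\ \sum_i w i <= 2 * \sum_i w i * h i.

(** At the height t = 2 D |c| / w, the weak-type inequality makes the points where
some field exceeds t carry at most half of w; h is the indicator of the rest. *)
Lemma good_subset (c : P * J -> R) : (forall x, 0 <= c x) ->
  exists2 h, H h & \sum_x c x * \sum_i w i * l x.1 x.2 i * h i <= (2 * #|P|%:R * D) * \sum_x c x.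
Proof.
move=> c0; set S := \sum_x c x; set W := \sum_i w i.
have S0 : 0 <= S by apply: sumr_ge0.
have W0 : 0 <= W by apply: sumr_ge0.
have D0 : 0 < D by rewrite mulr_gt0//; have := B0; lra.
have CS0 : 0 <= 2 * #|P|%:R * D * S.
  by rewrite mulr_ge0// mulr_ge0 ?(ltW D0)// mulr_ge0.
have H1 : H (fun=> 1).
  split; first by move=> i; rewrite ler01 lexx.
  by under [in leRHS]eq_bigr do rewrite mulr1; rewrite -/W; lra.
have zero (Z : finType) (r : Z -> R) : (forall z, 0 <= r z) -> \sum_z r z <= 0 -> forall z, r z = 0.
  move=> r0 rle; have /eqP : \sum_z r z = 0 by apply/le_anti; rewrite rle sumr_ge0.
  by rewrite psumr_eq0// => /allP + z => /(_ z); rewrite mem_index_enum => /(_ isT)/eqP.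
have [Wpos|W1] := ltP 0 W; last first.
  have {}W1 := zero _ w w0 W1.
  exists (fun=> 1) => //; rewrite big1 ?CS0// => x _.
  by rewrite big1 ?mulr0// => i _; rewrite W1 !mul0r.
have [Spos|S1] := ltP 0 S; last first.
  have {}S1 := zero _ c c0 S1.
  by exists (fun=> 1) => //; rewrite big1 ?CS0// => x _; rewrite S1 mul0r.
pose t := 2 * D * S / W.
have t0 : 0 < t by rewrite divr_gt0// mulr_gt0// mulr_gt0.
pose f p i := \sum_j c (p, j) * l p j i.
pose good i := [forall p, `|f p i| <= t].
exists (fun i => (good i)%:R).
  split; first by move=> i; case: (good i); rewrite !lexx ?ler01.
  have weak p : t * \sum_(i | t < `|f p i|) w i <= D * \sum_j c (p, j).
    by apply: (@weak_type _ _ _ (k p) (l p) w (fun j => c (p, j)) q q' B) => // j; exact: c0.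
  have bad : t * \sum_(i | ~~ good i) w i <= D * S.
    apply: (@le_trans _ _ (\sum_p t * \sum_(i | t < `|f p i|) w i)).
      rewrite -mulr_sumr ler_wpM2l ?(ltW t0)//.
      under [leRHS]eq_bigr do rewrite big_mkcond.
      rewrite exchange_big/= big_mkcond; apply: ler_sum => i _.
      case: ifPn => [|_]; last by apply: sumr_ge0 => p _; case: ifP.
      rewrite negb_forall => /existsP[p]; rewrite -ltNge => tf.
      rewrite (bigD1 p)//= tf lerDl; apply: sumr_ge0 => p' _; by case: ifP.
    rewrite (_ : S = \sum_p \sum_j c (p, j)).
      by rewrite mulr_sumr; apply: ler_sum.
    by rewrite pair_bigA/=; apply: eq_bigr => -[].
  have -> : \sum_i w i * (good i)%:R = W - \sum_(i | ~~ good i) w i.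
    rewrite /W (bigID good)/= [in RHS](bigID good)/= addrK [X in _ + X]big1 ?addr0.
      by apply: eq_bigr => i ->; rewrite mulr1.
    by move=> i /negbTE ->; rewrite mulr0.
  suff : \sum_(i | ~~ good i) w i <= W / 2 by rewrite -/W; lra.
  rewrite -(ler_pM2l t0); apply: (le_trans bad).
  rewrite /t le_eqVlt; apply/orP; left; apply/eqP; field; exact: lt0r_neq0.
have -> : \sum_x c x * (\sum_i w i * l x.1 x.2 i * (good i)%:R) =
    \sum_i w i * (good i)%:R * \sum_p f p i.
  under eq_bigr do rewrite mulr_sumr.
  rewrite exchange_big/=; apply: eq_bigr => i _; rewrite mulr_sumr /f.
  under [RHS]eq_bigr do rewrite mulr_sumr.
  by rewrite pair_bigA/=; apply: eq_bigr => -[p j] _ /=; ring.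
apply: (@le_trans _ _ (\sum_i w i * (#|P|%:R * t))).
  apply: ler_sum => i _; rewrite -mulrA ler_wpM2l//.
  have [/forallP gi|_] := boolP (good i); last by rewrite mul0r mulr_ge0// ltW.
  rewrite mul1r mulr_natl -sumr_const; apply: ler_sum => p _.
  exact: le_trans (ler_norm _) (gi p).
rewrite -mulr_suml -/W /t le_eqVlt; apply/orP; left; apply/eqP; field.
exact: lt0r_neq0.
Qed.

Lemma finite_game e : 0 < e -> exists h : I -> R,
  [/\ forall i, 0 <= h i <= 1, \sum_i w i <= 2 * \sum_i w i * h i &
      forall p j, \sum_i w i * l p j i * h i <= 2 * #|P|%:R * D + e].
Proof.
move=> e0; pose a (x : P * J) i := w i * l x.1 x.2 i.
set C := 2 * #|P|%:R * D.
pose M := \sum_x ((\sum_i `|a x i|) + `|C|) ^+ 2.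
have [||||h [h01 hw] hC] := @approachability R _ I a H C M _ _ _ _ e e0.
- exists (fun=> 1); split; first by move=> i; rewrite ler01 lexx.
  under [in leRHS]eq_bigr do rewrite mulr1.
  have : 0 <= \sum_i w i by apply: sumr_ge0.
  lra.
- move=> h h' t [h01 hw] [h'01 h'w] /andP[t0 t1]; split.
    by move=> i; have := h01 i; have := h'01 i; nra.
  have -> : \sum_i w i * ((1 - t) * h i + t * h' i) =
    (1 - t) * (\sum_i w i * h i) + t * \sum_i w i * h' i.
    by rewrite !mulr_sumr -big_split/=; apply: eq_bigr => i _; ring.
  nra.
- move=> h [h01 _]; apply: ler_sum => x _.
  have nn : 0 <= (\sum_i `|a x i|) + `|C| by rewrite addr_ge0// sumr_ge0.
  rewrite -[leLHS]real_normK ?num_real// ler_sqr ?nnegrE//.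
  apply: (le_trans (ler_normB _ _)); rewrite lerD2r.
  apply: (le_trans (ler_norm_sum _ _ _)); apply: ler_sum => i _.
  rewrite normrM ler_piMr//; have /andP[? ?] := h01 i; by rewrite ger0_norm.
- exact: good_subset.
- by exists h; split => // p j; exact: (hC (p, j)).
Qed.

End finite_game.

(** * The triple weight and the Euclidean norm *)

Section triple_weight.
Variables (R : realType) (s b : R).
Hypotheses (b0 : 0 < b) (bs : b <= s).
Implicit Types a c e x y t : R.
Local Notation tw := (triple_weight R s b).

(** What remains of the triple weight after forgetting a third side: x is the
shortest side and y another one. *)
Definition pair_weight x y : R :=
  if x <= y then x `^ (b - s) * y `^ (- (s + b)) else 0.

Lemma triple_weight_ge0 a c e : 0 <= tw a c e.
Proof. by rewrite mulr_ge0// powR_ge0. Qed.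

Lemma pair_weight_ge0 x y : 0 <= pair_weight x y.
Proof. by rewrite /pair_weight; case: ifP => // _; rewrite mulr_ge0// powR_ge0. Qed.

Let bs0 : b - s <= 0. Proof. by rewrite subr_le0. Qed.

Let sb0 : - (s + b) <= 0.
Proof. by rewrite oppr_le0 addr_ge0// ltW// (lt_le_trans b0). Qed.

Lemma triple_weight_anti a c e a' c' e' : 0 < a -> 0 < c -> 0 < e ->
  a <= a' -> c <= c' -> e <= e' -> tw a' c' e' <= tw a c e.
Proof.
move=> a0 c0 e0 aa cc ee; apply: ler_pM; rewrite ?powR_ge0//; apply: ler_npowR => //.
- by rewrite !lt_min a0 c0 e0.
- by rewrite !le_min !ge_min aa cc ee !orbT.
- by rewrite lt_max a0.
- by rewrite !ge_max !le_max aa cc ee !orbT.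
Qed.

Lemma triple_weight2 a c e : 0 < a -> 0 < c -> 0 < e ->
  tw a c e = 4 `^ s * tw (2 * a) (2 * c) (2 * e).
Proof.
move=> a0 c0 e0; rewrite /triple_weight.
rewrite -!(minr_pMr _ _ (ler0n R 2)) -!(maxr_pMr _ _ (ler0n R 2)).
have m0 : 0 <= Num.min a (Num.min c e) by rewrite !le_min !ltW.
have M0 : 0 <= Num.max a (Num.max c e) by rewrite !le_max ltW.
rewrite !powRM// mulrACA -powR_gt0D//.
have -> : b - s + - (s + b) = - (s + s) by ring.
rewrite (powRN 2) (powR_gt0D _ 2)// -powRM// (_ : 2 * 2 = 4); last by ring.
by rewrite mulVKf// gt_eqF// powR_gt0.
Qed.

Lemma triple_weight_lb a c e t : 0 < a -> 0 < c -> 0 < e ->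
  a <= t -> c <= t -> e <= t -> (t `^ s) ^- 2 <= tw a c e.
Proof.
move=> a0 c0 e0 at_ ct et; have t0 : 0 < t by apply: lt_le_trans at_.
have -> : (t `^ s) ^- 2 = t `^ (b - s) * t `^ (- (s + b)).
  rewrite -powR_gt0D// -powR_mulrn ?powR_ge0// -powRN -powRrM; congr (_ `^ _); ring.
apply: ler_pM; rewrite ?powR_ge0//; apply: ler_npowR => //.
- by rewrite !lt_min a0 c0 e0.
- by rewrite ge_min at_.
- by rewrite lt_max a0.
- by rewrite !ge_max at_ ct et.
Qed.

(** In each of the three terms the two sides share a vertex of the triangle, one of
them being the shortest side. *)
Lemma triple_weight_le_pairs a c e : 0 < a -> 0 < c -> 0 < e ->
  tw a c e <= pair_weight a c + pair_weight e a + pair_weight c a.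
Proof.
move=> a0 c0 e0.
have P x y z : 0 < y -> x <= y -> y <= z -> 0 <= x `^ (b - s) * z `^ (- (s + b)) <= pair_weight x y.
  move=> y0 xy yz; rewrite mulr_ge0 ?powR_ge0//= /pair_weight xy ler_wpM2l ?powR_ge0//.
  exact: ler_npowR.
have ? := pair_weight_ge0 a c; have ? := pair_weight_ge0 e a; have ? := pair_weight_ge0 c a.
rewrite /triple_weight.
set M := Num.max a _.
have aM : a <= M by rewrite le_max lexx.
have cM : c <= M by rewrite !le_max lexx orbT.
have [ac|/ltW ca] := leP a c; have [ce|/ltW ec] := leP c e.
- by rewrite (min_l ac); have /andP[_] := P _ _ _ c0 ac cM; lra.
- have [ae|/ltW ea] := leP a e; first by have /andP[_] := P _ _ _ c0 ac cM; lra.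
  by have /andP[_] := P _ _ _ a0 ea aM; lra.
- by rewrite (min_r ca); have /andP[_] := P _ _ _ a0 ca aM; lra.
- rewrite (min_r (le_trans ec ca)).
  by have /andP[_] := P _ _ _ a0 (le_trans ec ca) aM; lra.
Qed.

End triple_weight.

Section enorm.
Variables (R : realType) (d : nat).
Implicit Types x y z : 'rV[R]_d.

Lemma enorm_ge0 x : 0 <= enorm x.
Proof. exact: sqrtr_ge0. Qed.

Lemma enorm_sqr x : enorm x ^+ 2 = \sum_i x 0 i ^+ 2.
Proof. by rewrite sqr_sqrtr// sumr_ge0// => i _; exact: sqr_ge0. Qed.

Lemma enormN x : enorm (- x) = enorm x.
Proof. by congr Num.sqrt; apply: eq_bigr => i _; rewrite !mxE sqrrN. Qed.

Lemma enormB x y : enorm (x - y) = enorm (y - x).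
Proof. by rewrite -enormN opprB. Qed.

Lemma coord_le_enorm x i : `|x 0 i| <= enorm x.
Proof.
rewrite -ler_sqr ?nnegrE ?enorm_ge0// enorm_sqr real_normK ?num_real//.
by rewrite (bigD1 i)//= lerDl sumr_ge0// => j _; exact: sqr_ge0.
Qed.

Lemma enorm_le_sum x : enorm x <= \sum_i `|x 0 i|.
Proof.
rewrite -ler_sqr ?nnegrE ?enorm_ge0 ?sumr_ge0// enorm_sqr expr2 mulr_suml.
apply: ler_sum => i _; rewrite -real_normK ?num_real// expr2 ler_wpM2l//.
by rewrite (bigD1 i)//= lerDl sumr_ge0.
Qed.

Lemma enorm_lt x e : 0 < e -> (forall i, `|x 0 i| < e / d.+1%:R) -> enorm x < e.
Proof.
move=> e0 xe; apply: (le_lt_trans (enorm_le_sum _)).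
apply: (@le_lt_trans _ _ (\sum_(i < d) e / d.+1%:R)).
  by apply: ler_sum => i _; exact: ltW.
rewrite sumr_const card_ord -[_ *+ d]mulr_natr mulrAC -mulrA gtr_pMr//.
by rewrite ltr_pdivrMr ?ltr0n// mul1r ltr_nat.
Qed.

(** The Cauchy-Schwarz inequality enters through the square of
|y| x - |x| y. *)
Lemma enormD x y : enorm (x + y) <= enorm x + enorm y.
Proof.
rewrite -ler_sqr ?nnegrE ?addr_ge0 ?enorm_ge0// sqrrD !enorm_sqr.
pose P := \sum_i x 0 i * y 0 i.
have -> : \sum_i (x + y) 0 i ^+ 2 = \sum_i x 0 i ^+ 2 + P *+ 2 + \sum_i y 0 i ^+ 2.
  by rewrite /P -sumrMnl -!big_split/=; apply: eq_bigr => i _; rewrite mxE sqrrD.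
rewrite lerD2r lerD2l ler_pMn2r//.
set a := enorm x; set c := enorm y.
have a0 : 0 <= a := enorm_ge0 x.
have c0 : 0 <= c := enorm_ge0 y.
have H : 0 <= \sum_i (c * x 0 i - a * y 0 i) ^+ 2.
  by apply: sumr_ge0 => i _; exact: sqr_ge0.
have E : \sum_i (c * x 0 i - a * y 0 i) ^+ 2 = c ^+ 2 * a ^+ 2 - 2 * a * c * P + a ^+ 2 * c ^+ 2.
  rewrite {1}[a ^+ 2]enorm_sqr {2}[c ^+ 2]enorm_sqr.
  transitivity (\sum_i (c ^+ 2 * (x 0 i ^+ 2) - 2 * a * c * (x 0 i * y 0 i) + a ^+ 2 * y 0 i ^+ 2)).
    by apply: eq_bigr => i _; ring.
  by rewrite big_split/= sumrB/= -!mulr_sumr.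
have [ac|ac] := ltP 0 (a * c).
  rewrite -subr_ge0 -(pmulr_rge0 _ ac); nra.
have : a = 0 \/ c = 0.
  have /eqP : a * c = 0 by apply/le_anti; rewrite ac mulr_ge0.
  by rewrite mulf_eq0 => /orP[] /eqP; [left|right].
have z0 (z : 'rV[R]_d) : enorm z = 0 -> forall i, z 0 i = 0.
  by move=> ez i; apply/eqP; rewrite -normr_le0 -ez coord_le_enorm.
by case => /z0 h; rewrite /P big1 ?mulr_ge0// => i _; rewrite h ?mul0r ?mulr0.
Qed.

Lemma enorm_triangle x y z : enorm (x - z) <= enorm (x - y) + enorm (y - z).
Proof. by apply: le_trans (enormD _ _); rewrite addrA subrK. Qed.

Lemma enorm_sub_le x y : enorm x - enorm y <= enorm (x - y).
Proof. by rewrite lerBlDr -[X in enorm X <= _](subrK y) enormD. Qed.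

Lemma enorm_lip x y : `|enorm x - enorm y| <= enorm (x - y).
Proof.
by rewrite ler_norml enorm_sub_le andbT lerNl opprB enormB enorm_sub_le.
Qed.

Lemma continuous_enorm : continuous (@enorm R d).
Proof.
move=> x A /nbhs_ballP[e/= e0 eA]; apply/nbhs_ballP.
exists (e / d.+1%:R) => /=; first by rewrite divr_gt0// ltr0n.
move=> y [_ xy]; apply: eA; apply: le_lt_trans (enorm_lip _ _) _.
by apply: enorm_lt => // i; rewrite !mxE; exact: xy.
Qed.

Lemma open_eball x r : open (eball x r).
Proof.
have -> : eball x r = (fun y => enorm (y - x)) @^-1` [set t | t < r] by [].
apply: open_comp; last exact: open_lt.
move=> y _; apply: continuous_comp; last exact: continuous_enorm.
by apply: continuousB => //; exact: cst_continuous.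
Qed.

Lemma measurable_enormB x : measurable_fun [set: 'rV[R]_d] (fun y => enorm (y - x)).
Proof.
apply: (measurability _ (RGenOpens.measurableE R)) => _ [_ [a [c ->] <-]].
rewrite setTI; apply: open_measurable_rV.
apply: open_comp; last exact: interval_open.
move=> y _; apply: continuous_comp; last exact: continuous_enorm.
by apply: continuousB => //; exact: cst_continuous.
Qed.

Lemma measurable_eball x r : measurable (eball x r).
Proof. by apply: open_measurable_rV; exact: open_eball. Qed.

Lemma rat_enorm_dense x e : 0 < e -> exists p : 'rV[rat]_d, enorm (x - map_mx ratr p) < e.
Proof.
move=> e0; have e1 : 0 < e / d.+1%:R by rewrite divr_gt0// ltr0n.
have /choice[p hp] : forall i, exists p : rat, ball (x 0 i) (e / d.+1%:R) (ratr p : R).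
  move=> i; have [||y [yb [p _ py]]] := @dense_rat R (ball (x 0 i) (e / d.+1%:R)).
  - by exists (x 0 i); exact: ballxx.
  - exact: ball_open.
  - by exists p; rewrite py.
exists (\row_i p i).
by apply: enorm_lt => // i; rewrite !mxE; exact: hp.
Qed.

End enorm.

(** * Point masses in Euclidean space *)

Section finite_configuration.
Variables (R : realType) (d n : nat) (s b : R).
Implicit Types (x z : 'rV[R]_d) (t : R).
Hypotheses (b0 : 0 < b) (b1 : b <= 1) (bs : b <= s) (sn : s + 1 <= n%:R).
Variables (I : finType) (y : I -> 'rV[R]_d) (w : I -> R) (e : R).
Hypotheses (e0 : 0 < e) (w0 : forall i, 0 <= w i).

Local Notation tw := (triple_weight R s b).

Definition trunc_dist (x : 'rV[R]_d) (t : R) (z : 'rV[R]_d) : R :=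
  Num.max (enorm (z - x)) t.

Local Notation D i j := (trunc_dist (y i) e (y j)).

Hypothesis wV : forall i, 0 < w i ->
  \sum_j \sum_k w j * w k * tw (D i j) (D i k) (D j k) <= 1.

Lemma trunc_dist_gt0 x t z : 0 < t -> 0 < trunc_dist x t z.
Proof. by move=> t0; rewrite /trunc_dist lt_max t0 orbT. Qed.

Lemma trunc_distC x t z : trunc_dist x t z = trunc_dist z t x.
Proof. by rewrite /trunc_dist enormB. Qed.

Lemma coord_le_trunc_dist x t z c : `|(z - x) 0 c| <= trunc_dist x t z.
Proof. by rewrite /trunc_dist le_max coord_le_enorm. Qed.

Lemma trunc_dist_triangle x t z z' t' : 0 <= t' ->
  trunc_dist x t z <= trunc_dist x t z' + trunc_dist z' t' z.
Proof.
move=> t'0; have N0 (u : 'rV[R]_d) := enorm_ge0 R d u.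
have T := enorm_triangle R d z z' x.
rewrite /trunc_dist ge_max; apply/andP; split.
  rewrite [leRHS]addrC; apply: (le_trans T); apply: lerD; by rewrite le_max lexx.
by rewrite -[leLHS]addr0; apply: lerD; rewrite le_max ?lexx ?t'0 ?orbT.
Qed.

Lemma trunc_dist_triangle2 x t z z' t' : t' <= t ->
  trunc_dist z t' z' <= trunc_dist x t z + trunc_dist x t z'.
Proof.
move=> tt'; have T := enorm_triangle R d z' x z.
have N0 := enorm_ge0 R d (z' - x).
rewrite (enormB R d x z) in T.
rewrite /trunc_dist ge_max; apply/andP; split.
  rewrite [leRHS]addrC; apply: (le_trans T); apply: lerD; by rewrite le_max lexx.
by rewrite -[leLHS]addr0; apply: lerD; rewrite le_max ?tt' ?N0 ?orbT.
Qed.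

(** A maximum principle.  The distance from x to any mass is at least half of the
distance from the mass nearest to x, and the weight decreases with the
distances. *)
Lemma potential_le x t : e <= t ->
  \sum_i \sum_k w i * w k * tw (trunc_dist x t (y i)) (trunc_dist x t (y k)) (D i k) <= 4 `^ s.
Proof.
move=> et; have t0 : 0 < t by apply: lt_le_trans et.
have [/existsP[i1 wi1]|] := boolP [exists i, 0 < w i]; last first.
  rewrite negb_exists => /forallP h; rewrite big1 ?powR_ge0// => i _.
  rewrite big1// => k _; suff -> : w i = 0 by rewrite !mul0r.
  by apply/le_anti; rewrite w0 andbT leNgt h.
case: (@arg_minP _ _ _ i1 (fun i => 0 < w i) (fun i => enorm (y i - x)) wi1) => i0 wi0 imin.
have aux (u v p1 p2 : R) : 0 <= u -> 0 <= v -> (0 < u -> 0 < v -> p1 <= 4 `^ s * p2) ->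
    u * v * p1 <= 4 `^ s * (u * v * p2).
  move=> u0 v0 up; have [u1|u1] := ltP 0 u; last first.
    by have -> : u = 0 by [apply/le_anti; rewrite u1 u0]; rewrite !mul0r mulr0.
  have [v1|v1] := ltP 0 v; last first.
    by have -> : v = 0 by [apply/le_anti; rewrite v1 v0]; rewrite !mulr0 !mul0r mulr0.
  by rewrite [leRHS]mulrCA ler_wpM2l ?up// mulr_ge0.
have near i : 0 < w i -> D i0 i <= 2 * trunc_dist x t (y i).
  move=> wi; have := imin i wi; have T := enorm_triangle R d (y i) x (y i0).
  rewrite /trunc_dist ge_max (enormB R d x) in T * => H.
  have A : enorm (y i - x) <= Num.max (enorm (y i - x)) t by rewrite le_max lexx.
  have B : t <= Num.max (enorm (y i - x)) t by rewrite le_max lexx orbT.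
  by apply/andP; split; lra.
rewrite -[leRHS]mulr1; apply: (@le_trans _ _ (4 `^ s *
    \sum_j \sum_k w j * w k * tw (D i0 j) (D i0 k) (D j k))); last first.
  by rewrite ler_wpM2l ?powR_ge0// wV.
rewrite mulr_sumr; apply: ler_sum => i _; rewrite mulr_sumr; apply: ler_sum => k _.
apply: aux => // wi wk.
rewrite triple_weight2 ?trunc_dist_gt0// ler_wpM2l ?powR_ge0//.
apply: triple_weight_anti => //; rewrite ?trunc_dist_gt0// ?near//.
by rewrite ler_peMl ?ler1n// ltW// trunc_dist_gt0.
Qed.

(** Two masses in the ball of radius 2 t form with its centre a triangle of sides at
most 4 t, so the potential at scale 2 t dominates the square of the density. *)
Lemma density_le x t : e <= t -> \sum_(i | enorm (y i - x) < 2 * t) w i <= 8 `^ s * t `^ s.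
Proof.
move=> et; have t0 : 0 < t by apply: lt_le_trans et.
have := @potential_le x (2 * t) _ => /(_ ltac:(lra)) H.
pose A := [pred i | enorm (y i - x) < 2 * t].
set S := \sum_(i | _) _.
have S0 : 0 <= S by apply: sumr_ge0.
have Q0 : 0 < (4 * t) `^ s by rewrite powR_gt0//; lra.
have {}H : S ^+ 2 * ((4 * t) `^ s) ^- 2 <= 4 `^ s.
  apply: le_trans H.
  have -> : S = \sum_i (if A i then w i else 0) by rewrite /S big_mkcond.
  rewrite expr2 -mulrA mulr_suml; apply: ler_sum => i _.
  rewrite mulr_suml mulr_sumr; apply: ler_sum => k _.
  have rhs0 : 0 <= w i * w k * tw (trunc_dist x (2 * t) (y i)) (trunc_dist x (2 * t) (y k)) (D i k).
    apply: mulr_ge0; [exact: mulr_ge0|exact: triple_weight_ge0].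
  case: ifPn => [/= Ai|_]; last by rewrite mul0r.
  case: ifPn => [/= Ak|_]; last by rewrite mul0r mulr0.
  rewrite mulrA ler_wpM2l ?mulr_ge0//.
  have T := enorm_triangle R d (y k) x (y i).
  rewrite (enormB R d x) in T.
  apply: triple_weight_lb => //; rewrite ?trunc_dist_gt0//; [lra..| | |];
    rewrite /trunc_dist ge_max; apply/andP; split; lra.
have {}H : S ^+ 2 <= (2 `^ s * (4 * t) `^ s) ^+ 2.
  move: H; rewrite ler_pdivrMr ?exprn_gt0// => /le_trans; apply.
  rewrite exprMn ler_wpM2r ?sqr_ge0// expr2 -powRM//.
  by rewrite (_ : 2 * 2 = 4)//; ring.
rewrite ler_sqr ?nnegrE ?mulr_ge0 ?powR_ge0// in H.
apply: (le_trans H); rewrite -!powRM ?mulr_ge0 ?(ltW t0)//.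
by rewrite mulrA (_ : 2 * 4 = 8)//; ring.
Qed.

(** The bound produced by the finite game for the 2 d signed coordinate kernels,
plus 1 for the excess that approachability leaves. *)
Definition potential_bound : R := 4 * d%:R * (4 * (4 + 2 * (n.+2%:R * 4 `^ s * 4 `^ s))) + 1.

(** The finite game is played with one kernel for each coordinate and each sign,
so that upper bounds for all of them bound absolute values. *)
Lemma finite_solution (J : finType) (x : J -> 'rV[R]_d) (t : J -> R) :
  (forall j, e <= t j) -> exists h : I -> R,
  [/\ forall i, 0 <= h i <= 1, \sum_i w i <= 2 * \sum_i w i * h i &
      forall j c, `|\sum_i w i * rker R s ((y i - x j) 0 c) (trunc_dist (x j) (t j) (y i)) * h i|
         <= potential_bound].
Proof.
move=> et; have t0 j : 0 < t j by apply: lt_le_trans (et j).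
pose C0 : R := n.+2%:R * 4 `^ s.
have C00 : 0 <= C0 by rewrite mulr_ge0// powR_ge0.
pose k (p : 'I_d * bool) i j := (-1) ^+ p.2 * rker R s ((y j - y i) 0 p.1) (D i j).
pose l (p : 'I_d * bool) j i := (-1) ^+ p.2 * rker R s ((y i - x j) 0 p.1) (trunc_dist (x j) (t j) (y i)).
have sg (p : 'I_d * bool) a c f : (-1) ^+ p.2 * a * ((-1) ^+ p.2 * c) -
    (-1) ^+ p.2 * a * ((-1) ^+ p.2 * f) + (-1) ^+ p.2 * c * ((-1) ^+ p.2 * f) =
    a * c - a * f + c * f :> R.
  by case: p => ? [] /=; ring.
have := @finite_game R ('I_d * bool)%type I J k l w
  (fun i j h => C0 * tw (D i j) (D i h) (D j h))
  (fun j i h => C0 * tw (trunc_dist (x j) (t j) (y i)) (trunc_dist (x j) (t j) (y h)) (D i h))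
  (C0 * 4 `^ s) => /(_ _ w0 _ _ _ _ _ _ _ 1 ltr01).
case.
- by move=> p i j; rewrite /k -mulrN -rkerN trunc_distC -opprB mxE.
- by rewrite mulr_ge0// powR_ge0.
- by move=> i j h; rewrite mulr_ge0// triple_weight_ge0.
- by move=> i j h; rewrite mulr_ge0// triple_weight_ge0.
- move=> p i j h; rewrite /k sg; apply: rker_sym_le => //; rewrite ?trunc_dist_gt0 ?coord_le_trunc_dist//.
  + by rewrite (trunc_distC (y j)); apply: trunc_dist_triangle; exact: ltW.
  + by apply: trunc_dist_triangle; exact: ltW.
  + exact: trunc_dist_triangle2.
  + by rewrite !mxE; ring.
- move=> p j i h; rewrite /l /k sg; apply: rker_sym_le => //; rewrite ?trunc_dist_gt0 ?coord_le_trunc_dist//.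
  + by rewrite (trunc_distC (y i)); apply: trunc_dist_triangle; exact: ltW.
  + by apply: trunc_dist_triangle; exact: ltW.
  + exact: trunc_dist_triangle2.
  + by rewrite !mxE; ring.
- move=> i wi; under eq_bigr do under eq_bigr do rewrite mulrCA.
  under eq_bigr do rewrite -mulr_sumr; rewrite -mulr_sumr ler_wpM2l//.
  apply: (le_trans (wV i wi)); rewrite -[leLHS](powRr0 4).
  by apply: ler_powR; [rewrite ler1n|exact: ltW (lt_le_trans b0 bs)].
- move=> j; under eq_bigr do under eq_bigr do rewrite mulrCA.
  under eq_bigr do rewrite -mulr_sumr; rewrite -mulr_sumr ler_wpM2l//.
  exact: potential_le.
move=> h [h01 hw hl]; exists h; split => // j c.
have cE : 2 * #|{: 'I_d * bool}|%:R * (4 * (4 + 2 * (C0 * 4 `^ s))) + 1 = potential_bound.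
  by rewrite card_prod card_ord card_bool natrM /potential_bound /C0; ring.
have H1 := hl (c, true) j; have H2 := hl (c, false) j; rewrite cE in H1 H2.
rewrite ler_norml; apply/andP; split.
  rewrite lerNl; apply: le_trans H1; rewrite -sumrN le_eqVlt; apply/orP; left; apply/eqP.
  by apply: eq_bigr => i _; rewrite /l/= expr1; ring.
apply: le_trans H2; rewrite le_eqVlt; apply/orP; left; apply/eqP.
by apply: eq_bigr => i _; rewrite /l/= expr0; ring.
Qed.

End finite_configuration.

(** * Energy of point masses and the Wolff energy *)

Section integral_lower_bounds.
Context {dd : measure_display} {T : measurableType dd} {R : realType}.
Variable mu : {measure set T -> \bar R}.
Local Open Scope ereal_scope.

Lemma integral_step (I : finType) (A : I -> set T) (a : I -> R) :
  (forall i, measurable (A i)) -> (forall i, (0 <= a i)%R) ->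
  \int[mu]_x (\sum_i (a i)%:E * (\1_(A i) x)%:E) = \sum_i (a i)%:E * mu (A i).
Proof.
move=> mA a0; have mI i : measurable_fun [set: T] (fun x => (\1_(A i) x)%:E : \bar R).
  by apply/measurable_EFinP; exact: measurable_indic.
rewrite (@ge0_integral_sum _ _ _ mu setT measurableT I
  (fun i x => (a i)%:E * (\1_(A i) x)%:E))//.
- apply: eq_bigr => i _; by rewrite ge0_integralZl_EFin// integral_indic// setIT.
- by move=> i; apply: measurable_funeM.
- by move=> i x _; rewrite mule_ge0 ?lee_fin ?indicE.
Qed.

(** The integral of a nonnegative function is the supremum over the simple
functions below it, measurable or not: the Wolff potential enters in this way. *)
Lemma ge0_integral_le (D : set T) (f g : T -> \bar R) : (forall x, 0 <= f x) ->
  (forall x, D x -> 0 <= g x) ->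
  (forall x, f x <= (g \_ D) x) -> \int[mu]_x f x <= \int[mu]_(x in D) g x.
Proof.
move=> f0 g0 fg; rewrite [leRHS]integral_mkcond !ge0_integralTE//; last first.
  by move=> x; exact: le_trans (f0 x) (fg x).
apply: le_ereal_sup => _ [h hf <-]; exists h => //= x.
exact: le_trans (hf x) (fg x).
Qed.

Lemma step_le_integral (I : finType) (A : I -> set T) (a : I -> R) (D : set T) (g : T -> \bar R) :
  (forall i, measurable (A i)) -> (forall i, (0 <= a i)%R) ->
  (forall i j x, A i x -> A j x -> i = j) ->
  (forall x, D x -> 0 <= g x) ->
  (forall i x, A i x -> D x /\ (a i)%:E <= g x) ->
  \sum_i (a i)%:E * mu (A i) <= \int[mu]_(x in D) g x.
Proof.
move=> mA a0 dA g0 Ag; rewrite -integral_step//; apply: ge0_integral_le => //.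
  by move=> x; apply: sume_ge0 => i _; rewrite mule_ge0 ?lee_fin ?indicE.
move=> x; have [[i Aix]|nA] := pselect (exists i, A i x).
  have [Dx agx] := Ag i x Aix.
  rewrite patchE mem_set// (bigD1 i)//= indicE mem_set// mule1 big1 ?adde0// => j ji.
  rewrite indicE memNset ?mule0// => Ajx; move: ji.
  by rewrite (dA _ _ _ Ajx Aix) eqxx.
rewrite big1 => [|i _]; last first.
  by rewrite indicE memNset ?mule0// => Aix; apply: nA; exists i.
by apply: erestrict_ge0.
Qed.

End integral_lower_bounds.

Section geometric.
Variables (R : realType) (r : R).
Hypotheses (r0 : 0 <= r) (r1 : r < 1).

Lemma geometric_right N k :
  \sum_(l < N) (if (k <= l)%N then r ^+ (l - k) else 0) <= (1 - r)^-1.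
Proof.
have r2 : 0 < 1 - r by rewrite subr_gt0.
rewrite -[leRHS]mul1r ler_pdivlMr//.
suff -> : (\sum_(l < N) (if (k <= l)%N then r ^+ (l - k) else 0)) * (1 - r) = 1 - r ^+ (N - k).
  by rewrite gerBl exprn_ge0.
elim: N => [|N IH]; first by rewrite big_ord0 sub0n expr0; ring.
rewrite big_ord_recr/= mulrDl IH; case: leqP => kN.
  by rewrite subSn// exprS; ring.
have -> : (N - k = 0)%N by apply/eqP; rewrite subn_eq0 ltnW.
have -> : (N.+1 - k = 0)%N by apply/eqP; rewrite subn_eq0.
by rewrite mul0r addr0.
Qed.

Lemma geometric_left N k :
  \sum_(l < N) (if (l <= k)%N then r ^+ (k - l) else 0) <= (1 - r)^-1.
Proof.
have r2 : 0 < 1 - r by rewrite subr_gt0.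
rewrite -[leRHS]mul1r ler_pdivlMr//.
apply: (@le_trans _ _ (r ^+ (k.+1 - N))); last by rewrite exprn_ile1// ltW.
elim: N => [|N IH]; first by rewrite big_ord0 mul0r exprn_ge0.
rewrite big_ord_recr/= mulrDl; case: leqP => kN.
  move: IH; rewrite subSS subSn// exprS => IH.
  by apply: (le_trans (lerD IH (lexx _))); rewrite le_eqVlt; apply/orP; left; apply/eqP; ring.
have -> : (k.+1 - N.+1 = 0)%N by apply/eqP; rewrite subn_eq0 ltnS ltnW.
move: IH; have -> : (k.+1 - N = 0)%N by apply/eqP; rewrite subn_eq0.
by rewrite mul0r addr0.
Qed.

(** Schur's test for the matrix r^(l-k), l >= k, whose rows and columns have sums
at most 1 / (1 - r). *)
Lemma geometric_form_le N (z : 'I_N -> R) :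
  \sum_(k < N) \sum_(l < N) (if (k <= l)%N then r ^+ (l - k) else 0) * (z k * z l) <=
  (1 - r)^-1 * \sum_k z k ^+ 2.
Proof.
pose m (k l : 'I_N) := if (k <= l)%N then r ^+ (l - k) else 0.
have m0 (k l : 'I_N) : 0 <= m k l by rewrite /m; case: ifP => // _; exact: exprn_ge0.
apply: (@le_trans _ _ (\sum_k \sum_l (m k l * (z k ^+ 2 / 2) + m k l * (z l ^+ 2 / 2)))).
  apply: ler_sum => k _; apply: ler_sum => l _; rewrite -mulrDr; apply: (ler_wpM2l (m0 k l)).
  by have := sqr_ge0 (z k - z l); rewrite sqrrB -mulr_natl; lra.
under eq_bigr do rewrite big_split/=.
rewrite big_split/= [X in _ + X]exchange_big/=.
have -> : (1 - r)^-1 * \sum_k z k ^+ 2 =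
    \sum_k (1 - r)^-1 * (z k ^+ 2 / 2) + \sum_k (1 - r)^-1 * (z k ^+ 2 / 2).
  by rewrite -big_split/= mulr_sumr; apply: eq_bigr => k _; field; rewrite subr_eq0 gt_eqF.
apply: lerD; apply: ler_sum => k _; rewrite -mulr_suml ler_wpM2r ?divr_ge0 ?sqr_ge0//.
  exact: geometric_right.
exact: geometric_left.
Qed.

End geometric.

Section dyadic_index.
Variables (R : realType) (e : R).
Hypothesis e0 : 0 < e.

(** The exponent k of the dyadic interval [2^k e, 2^(k+1) e) containing a >= e. *)
Definition dyadic_index (a : R) : nat := trunc_log 2 (Num.truncn (a / e)).

Lemma dyadic_indexP a : e <= a ->
  2 ^+ dyadic_index a * e <= a < 2 ^+ (dyadic_index a).+1 * e.
Proof.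
move=> ea; have ae : 1 <= a / e by rewrite ler_pdivlMr// mul1r.
have t0 : (0 < Num.truncn (a / e))%N by rewrite truncn_gt0.
have /andP[h1 h2] := @trunc_log_bounds 2 _ isT t0.
have /andP[h3 h4] : (Num.truncn (a / e))%:R <= a / e < (Num.truncn (a / e)).+1%:R.
  by apply: truncn_itv; apply: le_trans ae.
rewrite -ler_pdivlMr// -ltr_pdivrMr//; apply/andP; split.
  by apply: le_trans h3; rewrite -natrX ler_nat.
by apply: (lt_le_trans h4); rewrite -natrX ler_nat.
Qed.

Lemma dyadic_index_le a c : e <= a -> a <= c -> (dyadic_index a <= dyadic_index c)%N.
Proof.
move=> ea ac; rewrite leqNgt; apply/negP => lt.
have /andP[h1 _] := dyadic_indexP a ea.
have /andP[_ h2] := dyadic_indexP c (le_trans ea ac).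
have : 2 ^+ (dyadic_index c).+1 * e <= 2 ^+ dyadic_index a * e.
  by rewrite ler_wpM2r ?(ltW e0)// ler_weXn2l// ler1n.
lra.
Qed.

End dyadic_index.

Section energy.
Variables (R : realType) (s b : R).
Hypotheses (b0 : 0 < b) (bs : b <= s).

Let s0 : 0 < s. Proof. exact: lt_le_trans bs. Qed.

Let r : R := 2 `^ (- b).

Let r01 : 0 < r < 1.
Proof.
rewrite powR_gt0//= /r powRN invf_lt1 ?powR_gt0// -[ltLHS](_ : 1 `^ b = 1); last by rewrite powR1.
by apply: gt0_ltr_powR; rewrite ?nnegrE// ltr1n.
Qed.

(** A Hardy-type inequality: sorting the points into dyadic shells around one of
them, the pair weight between shells k <= l decays like 2^(-b (l - k)). *)
Lemma pair_weight_sum_le (I : finType) (e : R) (a m : I -> R) (N : nat) :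
  0 < e -> (forall i, 0 <= m i) -> (forall i, e <= a i) ->
  (forall i, (dyadic_index R e (a i) < N)%N) ->
  \sum_i \sum_j m i * m j * pair_weight R s b (a i) (a j) <=
  (1 - r)^-1 * \sum_(k < N)
    ((\sum_(i | dyadic_index R e (a i) == k) m i) / (2 ^+ k * e) `^ s) ^+ 2.
Proof.
move=> e0 m0 ea kN; have /andP[r0 r1] := r01.
pose p (k : nat) : R := 2 ^+ k * e.
have p0 k : 0 < p k by rewrite mulr_gt0// exprn_gt0.
pose kap i : 'I_N := Ordinal (kN i).
pose mat (k l : nat) := if (k <= l)%N then r ^+ (l - k) else 0.
pose t (k : nat) := (p k `^ s)^-1.
pose M (k : 'I_N) := \sum_(i | dyadic_index R e (a i) == k) m i.
apply: le_trans (geometric_form_le R r (ltW r0) r1 N (fun k => M k / p k `^ s)).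
have E : \sum_(k < N) \sum_(l < N) mat k l * (M k / p k `^ s * (M l / p l `^ s)) =
    \sum_i \sum_j m i * m j * (mat (kap i) (kap j) * (t (kap i) * t (kap j))).
  rewrite [RHS](partition_big kap xpredT)//=; apply: eq_bigr => k _.
  under [RHS]eq_bigr do rewrite (partition_big kap xpredT)//=.
  rewrite exchange_big/=; apply: eq_bigr => l _.
  transitivity (\sum_(i | kap i == k) \sum_(j | kap j == l) (m i * m j) * (mat k l * (t k * t l))).
    under [RHS]eq_bigr do rewrite -mulr_suml -mulr_sumr.
    by rewrite -!mulr_suml /M /t; ring.
  apply: eq_bigr => i /eqP ik; apply: eq_bigr => j /eqP jl.
  by rewrite -(congr1 (@nat_of_ord N) ik) -(congr1 (@nat_of_ord N) jl).
rewrite [leRHS]E; apply: ler_sum => i _; apply: ler_sum => j _.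
rewrite ler_wpM2l ?mulr_ge0// /pair_weight.
have t0 k : 0 < t k by rewrite invr_gt0 powR_gt0.
have mat0 k l : 0 <= mat k l by rewrite /mat; case: ifP => // _; rewrite exprn_ge0// ltW.
case: ifPn => [aij|_]; last by rewrite !mulr_ge0// ltW.
have kij := dyadic_index_le R e e0 _ _ (ea i) aij.
have /andP[hi _] := dyadic_indexP R e e0 (a i) (ea i).
have /andP[hj _] := dyadic_indexP R e e0 (a j) (ea j).
rewrite /mat kij /=.
move: (dyadic_index R e (a i)) (dyadic_index R e (a j)) kij hi hj => k l kl hi hj.
apply: (@le_trans _ _ (p k `^ (b - s) * p l `^ (- (s + b)))).
  apply: ler_pM; rewrite ?powR_ge0//; apply: ler_npowR => //.
  - by rewrite subr_le0.
  - by rewrite oppr_le0 addr_ge0// ltW.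
rewrite opprD !powR_gt0D// /t -!powRN.
have -> : p k `^ b * p k `^ (- s) * (p l `^ (- s) * p l `^ (- b)) =
  (p k `^ b * p l `^ (- b)) * (p k `^ (- s) * p l `^ (- s)) by ring.
rewrite ler_wpM2r ?mulr_ge0 ?powR_ge0//.
have -> : p l = 2 ^+ (l - k) * p k by rewrite /p mulrA -exprD subnK.
rewrite powRM ?exprn_ge0 ?(ltW (p0 k))// mulrCA -powR_gt0D// subrr powRr0 mulr1.
by rewrite -powR_mulrn// -powRrM mulrC powRrM powR_mulrn ?powR_ge0.
Qed.

(** Each triangle is charged to a vertex of its shortest side; permuting the
summation indices makes the three charges equal. *)
Lemma triple_energy_le (I : finType) (m : I -> R) (D : I -> I -> R) :
  (forall i, 0 <= m i) -> (forall i j, 0 < D i j) -> (forall i j, D i j = D j i) ->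
  \sum_i m i * (\sum_j \sum_k m j * m k * triple_weight R s b (D i j) (D i k) (D j k)) <=
  3 * \sum_i m i * \sum_j \sum_k m j * m k * pair_weight R s b (D i j) (D i k).
Proof.
move=> m0 D0 DC.
pose F i j k := m i * m j * m k * pair_weight R s b (D i j) (D i k).
set S := \sum_i m i * \sum_j \sum_k m j * m k * pair_weight R s b (D i j) (D i k).
have E1 : S = \sum_i \sum_j \sum_k F i j k.
  apply: eq_bigr => i _; rewrite mulr_sumr; apply: eq_bigr => j _; rewrite mulr_sumr.
  by apply: eq_bigr => k _; rewrite /F; ring.
have E2 : S = \sum_i \sum_j \sum_k F j k i.
  by rewrite E1 [RHS]exchange_big; apply: eq_bigr => i _; rewrite [RHS]exchange_big.
have E3 : S = \sum_i \sum_j \sum_k F i k j.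
  by rewrite E1; apply: eq_bigr => i _; rewrite exchange_big.
apply: (@le_trans _ _ (\sum_i \sum_j \sum_k (F i j k + F j k i + F i k j))); last first.
  rewrite (_ : 3 * S = S + S + S); last by ring.
  rewrite {1}E1 {1}E2 E3 -!big_split/= le_eqVlt; apply/orP; left; apply/eqP.
  apply: eq_bigr => i _; rewrite -!big_split/=; apply: eq_bigr => j _.
  by rewrite -!big_split/=.
apply: ler_sum => i _; rewrite [leLHS]mulr_sumr; apply: ler_sum => j _.
rewrite [leLHS]mulr_sumr; apply: ler_sum => k _.
have -> : F i j k + F j k i + F i k j = m i * (m j * m k * (pair_weight R s b (D i j) (D i k)
  + pair_weight R s b (D j k) (D i j) + pair_weight R s b (D i k) (D i j))).
  by rewrite /F (DC j i); ring.
by rewrite ler_wpM2l// ler_wpM2l ?mulr_ge0// triple_weight_le_pairs.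
Qed.

Section wolff_ge.
Variables (d : nat) (mu : {measure set 'rV[R]_d -> \bar R}).
Hypothesis muT : (mu setT < +oo)%E.

Lemma measure_lty (A : set 'rV[R]_d) : measurable A -> (mu A < +oo)%E.
Proof. by move=> mA; apply: le_lt_trans muT; apply: le_measure; rewrite ?inE. Qed.

Lemma measure_fineE (A : set 'rV[R]_d) : measurable A -> mu A = (fine (mu A))%:E.
Proof. by move=> mA; rewrite fineK// ge0_fin_numE// measure_lty. Qed.

Lemma wolff_integrandE z t : 0 < t ->
  ((mu (eball z t) / (t `^ s)%:E) ^+ 2 * (t^-1)%:E)%E =
  ((fine (mu (eball z t)) / t `^ s) ^+ 2 * t^-1)%:E.
Proof.
move=> t0; rewrite measure_fineE; last exact: measurable_eball.
rewrite inver gt_eqF ?powR_gt0//.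
Qed.

Definition wolff_dyadic_const : R := ((8 `^ s) ^+ 2 * 2)^-1.

(** The integrand is bounded below on the disjoint intervals
(2^(k+2) e, 2^(k+3) e], where the balls already contain the k-th shell. *)
Lemma wolff_ge z e N (M : nat -> R) : 0 < e -> (forall k, 0 <= M k) ->
  (forall k t, (k < N)%N -> 2 ^+ k.+2 * e < t -> M k <= fine (mu (eball z t))) ->
  ((wolff_dyadic_const * \sum_(k < N) (M k / (2 ^+ k * e) `^ s) ^+ 2)%:E <= wolff s mu z)%E.
Proof.
move=> e0 M0 HM.
pose p (k : nat) : R := 2 ^+ k * e.
have p0 k : 0 < p k by rewrite mulr_gt0// exprn_gt0.
have pS k : p k.+1 = 2 * p k by rewrite /p exprS mulrA.
pose A (k : 'I_N) : set R := `]p k.+2, p k.+3]%classic.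
pose a (k : 'I_N) := (M k / p k.+3 `^ s) ^+ 2 * (p k.+3)^-1.
have mA k : measurable (A k) by exact: measurable_itv.
have a0 k : 0 <= a k by rewrite mulr_ge0 ?sqr_ge0// invr_ge0 ltW.
have dA (k l : 'I_N) t : A k t -> A l t -> k = l.
  have pm k' l' : (k' <= l')%N -> p k' <= p l'.
    by move=> kl; rewrite ler_wpM2r ?(ltW e0)// ler_weXn2l// ler1n.
  rewrite /A/= !in_itv/= => /andP[h1 h2] /andP[h3 h4].
  have [lt|lt|kl] := ltngtP k l; last exact: ord_inj.
    have le := pm k.+3 l.+2 lt; have := lt_le_trans h3 (le_trans h2 le).
    by rewrite ltxx.
  have le := pm l.+3 k.+2 lt; have := lt_le_trans h1 (le_trans h4 le).
  by rewrite ltxx.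
have g0 t : `]0%R, +oo[%classic t -> (0 <= (mu (eball z t) / (t `^ s)%:E) ^+ 2 * (t^-1)%:E)%E.
  rewrite /= in_itv/= andbT => t0.
  by rewrite wolff_integrandE// lee_fin mulr_ge0 ?sqr_ge0// invr_ge0 ltW.
have Ag k t : A k t -> `]0%R, +oo[%classic t /\
    ((a k)%:E <= (mu (eball z t) / (t `^ s)%:E) ^+ 2 * (t^-1)%:E)%E.
  rewrite /A /= !in_itv/= andbT => /andP[h1 h2].
  have t0 : 0 < t by apply: lt_trans h1.
  split => //; rewrite wolff_integrandE// lee_fin.
  have T0 : 0 < t `^ s by rewrite powR_gt0.
  have P0 : 0 < p k.+3 `^ s by rewrite powR_gt0.
  apply: ler_pM; rewrite ?sqr_ge0 ?invr_ge0 ?(ltW (p0 _))//; last first.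
    by rewrite lef_pV2// posrE.
  rewrite ler_sqr ?nnegrE ?divr_ge0 ?(ltW T0) ?(ltW P0) ?fine_ge0//.
  apply: ler_pM => //; rewrite ?invr_ge0 ?(ltW P0)//; first exact: HM.
  rewrite lef_pV2// ?posrE//; apply: ge0_ler_powR; rewrite ?nnegrE ?(ltW s0) ?(ltW t0) ?(ltW (p0 _))//.
have lA k : lebesgue_measure (A k) = (p k.+3 - p k.+2)%:E.
  rewrite /A lebesgue_measure_itv/= lte_fin ifT//.
  by rewrite [p k.+3]pS ltr_pMl// ltr1n.
apply: le_trans (step_le_integral (@lebesgue_measure R) _ A a _ _ mA a0 dA g0 Ag).
rewrite le_eqVlt; apply/orP; left; apply/eqP.
rewrite mulr_sumr -sumEFin; apply: eq_bigr => k _.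
rewrite [X in (_ * X)%E]lA -EFinM; congr (_%:E).
have -> : p k.+3 = 8 * p k by rewrite !pS; ring.
have -> : p k.+2 = 4 * p k by rewrite !pS; ring.
rewrite /a /wolff_dyadic_const.
have -> : p k.+3 = 8 * p k by rewrite !pS; ring.
rewrite powRM ?(ltW (p0 k))// -/(p k).
have := p0 k; have : 0 < p k `^ s by rewrite powR_gt0.
have : 0 < 8 `^ s :> R by rewrite powR_gt0.
move: (8 `^ s) (p k `^ s) (p k) => A1 A2 A3 *; field.
by rewrite !gt_eqF.
Qed.

Definition energy_const : R := 3 * (1 - r)^-1 / wolff_dyadic_const.

Lemma energy_const_gt0 : 0 < energy_const.
Proof.
have /andP[_ r1] := r01.
by rewrite /energy_const divr_gt0// ?mulr_gt0 ?invr_gt0 ?subr_gt0 ?mulr_gt0 ?exprn_gt0 ?powR_gt0.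
Qed.

Lemma wolff_ge0 z : (0 <= wolff s mu z)%E.
Proof.
apply: integral_ge0 => t; rewrite /= in_itv/= andbT => t0.
by rewrite wolff_integrandE// lee_fin mulr_ge0 ?sqr_ge0// invr_ge0 ltW.
Qed.

Variables (I : finType) (y : I -> 'rV[R]_d) (Q : I -> set 'rV[R]_d) (e : R).
Hypotheses (e0 : 0 < e) (mQ : forall i, measurable (Q i))
  (dQ : forall i j z, Q i z -> Q j z -> i = j) (Qy : forall i, Q i `<=` eball (y i) e).

Let m i := fine (mu (Q i)).

Let m0 i : 0 <= m i. Proof. exact: fine_ge0. Qed.

Local Notation D i j := (trunc_dist R d (y i) e (y j)).

Let shell_le (P : pred I) (B : set 'rV[R]_d) : measurable B ->
  (forall i, P i -> Q i `<=` B) -> \sum_(i | P i) m i <= fine (mu B).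
Proof.
move=> mB QB; rewrite -lee_fin -measure_fineE//.
pose A i := if P i then Q i else set0.
have mA i : measurable (A i) by rewrite /A; case: ifP.
have dA i j x : A i x -> A j x -> i = j.
  by rewrite /A; case: ifP => // _; case: ifP => // _; exact: dQ.
have AB i x : A i x -> B x /\ (1%:E <= 1%E :> \bar R)%E.
  by rewrite /A; case: ifPn => // /QB QBi /QBi.
have := step_le_integral mu _ A (fun=> 1) B (fun=> 1%E) mA (fun=> ler01) dA (fun _ _ => lee01) AB.
rewrite integral_cst// mul1e; apply: le_trans.
rewrite big_mkcond -sumEFin le_eqVlt; apply/orP; left; apply/eqP.
apply: eq_bigr => i _; rewrite mul1e /A; case: ifP => _; last by rewrite measure0.
by rewrite -measure_fineE.
Qed.

(** The points of a cell Q i are within e of y i, so the shells around y i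
are contained in the balls around any point of the cell. *)
Lemma energy_le :
  ((\sum_i m i * \sum_j \sum_k m j * m k * triple_weight R s b (D i j) (D i k) (D j k))%:E
    <= energy_const%:E * wolff_energy s mu)%E.
Proof.
pose U i := \sum_j \sum_k m j * m k * pair_weight R s b (D i j) (D i k).
have D0 i j : 0 < D i j by exact: trunc_dist_gt0.
have DC i j : D i j = D j i by rewrite trunc_distC.
have H1 : \sum_i m i * (\sum_j \sum_k m j * m k * triple_weight R s b (D i j) (D i k) (D j k))
    <= 3 * \sum_i m i * U i.
  exact: triple_energy_le.
have /andP[r0 r1] := r01.
have r2 : 0 < 1 - r by rewrite subr_gt0.
have w0 : 0 < wolff_dyadic_const by rewrite invr_gt0 mulr_gt0// exprn_gt0// powR_gt0.
have U0 i : 0 <= U i.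
  apply: sumr_ge0 => j _; apply: sumr_ge0 => k _; apply: mulr_ge0; first exact: mulr_ge0.
  exact: pair_weight_ge0.
pose c := wolff_dyadic_const * (1 - r).
have c0 : 0 < c by rewrite mulr_gt0.
have H2 i z : Q i z -> ((c * U i)%:E <= wolff s mu z)%E.
  move=> Qz; pose N := (\max_j dyadic_index R e (D i j)).+1.
  pose M (k : nat) := \sum_(j | dyadic_index R e (D i j) == k) m j.
  have De j : e <= D i j by rewrite /trunc_dist le_max lexx orbT.
  apply: le_trans (@wolff_ge z e N M e0 _ _).
  - rewrite lee_fin /c -mulrA ler_wpM2l ?(ltW w0)// mulrC -ler_pdivlMr// mulrC.
    apply: pair_weight_sum_le => // j.
    by rewrite /N ltnS (leq_bigmax j).
  - by move=> k; exact: sumr_ge0.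
  - move=> k t kN kt; apply: shell_le; first exact: measurable_eball.
    move=> j /eqP jk x Qx; rewrite /eball/=.
    have /andP[_] := dyadic_indexP R e e0 _ (De j); rewrite jk => h.
    have h1 : enorm (y j - y i) < 2 ^+ k.+1 * e.
      by apply: le_lt_trans h; rewrite /trunc_dist le_max lexx.
    have h2 := Qy j x Qx; have h3 := Qy i z Qz; rewrite /eball/= in h2 h3.
    have T1 := enorm_triangle R d x (y j) z.
    have T2 := enorm_triangle R d (y j) (y i) z.
    rewrite enormB in h3.
    have : 2 ^+ k.+2 * e = 2 * (2 ^+ k.+1 * e) by rewrite [in LHS]exprS; ring.
    have : e <= 2 ^+ k * e by rewrite ler_peMl ?(ltW e0)// exprn_ege1// ler1n.
    have : 2 ^+ k.+1 * e = 2 * (2 ^+ k * e) by rewrite exprS; ring.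
    lra.
have H3 : ((\sum_i c * U i * m i)%:E <= wolff_energy s mu)%E.
  have a0 i : 0 <= c * U i by rewrite mulr_ge0// ltW.
  have Qg i x : Q i x -> setT x /\ ((c * U i)%:E <= wolff s mu x)%E by move=> /H2.
  apply: le_trans (step_le_integral mu _ Q _ _ _ mQ a0 dQ (fun x _ => wolff_ge0 x) Qg).
  rewrite -sumEFin le_eqVlt; apply/orP; left; apply/eqP; apply: eq_bigr => i _.
  by rewrite EFinM -measure_fineE.
have -> : energy_const%:E = ((3 * c^-1)%:E)%E.
  by rewrite /energy_const /c invfM mulrA mulrAC.
apply: (@le_trans _ _ (((3 * c^-1)%:E * (\sum_i c * U i * m i)%:E)%E)); last first.
  by rewrite lee_wpmul2l// lee_fin mulr_ge0// invr_ge0 ltW.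
rewrite -EFinM lee_fin; apply: (le_trans H1); rewrite -mulrA ler_wpM2l// mulr_sumr.
apply: ler_sum => i _; rewrite le_eqVlt; apply/orP; left; apply/eqP; field.
exact: lt0r_neq0.
Qed.

End wolff_ge.
End energy.

(** * Weak sequential compactness of densities *)

Section weak_compactness.
Context {dd : measure_display} {T : measurableType dd} {R : realType}.
Variable mu : {measure set T -> \bar R}.
Hypothesis muT : (mu setT < +oo)%E.

Definition bounded_measurable (f : T -> R) :=
  measurable_fun [set: T] f /\ exists C, forall x, `|f x| <= C.

Definition unit_function (h : T -> R) :=
  measurable_fun [set: T] h /\ forall x, 0 <= h x <= 1.

Lemma bounded_measurable_integrable f : bounded_measurable f ->
  mu.-integrable setT (EFin \o f).
Proof.
move=> [mf [C fC]]; apply: measurable_bounded_integrable => //.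
exists C; split; first exact: num_real.
by move=> M CM x _; apply: le_trans (ltW CM).
Qed.

Lemma unit_function_bounded h : unit_function h -> bounded_measurable h.
Proof.
move=> [mh h01]; split => //; exists 1 => x.
by have /andP[h0 h1] := h01 x; rewrite ger0_norm.
Qed.

Lemma bounded_measurableM f g : bounded_measurable f -> bounded_measurable g ->
  bounded_measurable (fun x => f x * g x).
Proof.
move=> [mf [C fC]] [mg [C' gC']]; split; first exact: measurable_funM.
by exists (C * C') => x; rewrite normrM ler_pM.
Qed.

Lemma bounded_measurableD f g : bounded_measurable f -> bounded_measurable g ->
  bounded_measurable (fun x => f x + g x).
Proof.
move=> [mf [C fC]] [mg [C' gC']]; split; first exact: measurable_funD.
by exists (C + C') => x; apply: le_trans (ler_normD _ _) (lerD _ _).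
Qed.

Lemma bounded_measurable_cst c : bounded_measurable (fun=> c).
Proof. by split => //; exists `|c|. Qed.

Lemma bounded_measurableZ c f : bounded_measurable f ->
  bounded_measurable (fun x => c * f x).
Proof. by move=> bf; apply: bounded_measurableM => //; exact: bounded_measurable_cst. Qed.

Lemma bounded_measurable_norm f : bounded_measurable f ->
  bounded_measurable (fun x => `|f x|).
Proof.
move=> [mf [C fC]]; split; last by exists C => x; rewrite normr_id.
exact: measurableT_comp.
Qed.

Lemma RintegralD_bounded f g : bounded_measurable f -> bounded_measurable g ->
  \int[mu]_x (f x + g x) = \int[mu]_x f x + \int[mu]_x g x.
Proof. by move=> bf bg; apply: RintegralD => //; exact: bounded_measurable_integrable. Qed.

Lemma RintegralZ_bounded c f : bounded_measurable f ->
  \int[mu]_x (c * f x) = c * \int[mu]_x f x.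
Proof. by move=> bf; apply: RintegralZl => //; exact: bounded_measurable_integrable. Qed.

Lemma le_Rintegral_bounded f g : bounded_measurable f -> bounded_measurable g ->
  (forall x, f x <= g x) -> \int[mu]_x f x <= \int[mu]_x g x.
Proof.
by move=> bf bg fg; apply: le_Rintegral => //; exact: bounded_measurable_integrable.
Qed.

Lemma Rintegral_EFin f : bounded_measurable f ->
  (\int[mu]_x (f x)%:E)%E = (\int[mu]_x f x)%:E.
Proof.
move=> bf; rewrite /Rintegral fineK//.
by apply: integrable_fin_num => //; exact: bounded_measurable_integrable.
Qed.

Lemma cvg_of_summable_increments (u : nat -> R) :
  (\sum_(0 <= k <oo) `|u k - u k.+1|%:E < +oo)%E -> cvgn u.
Proof.
move=> fin; have -> : u = fun n => u 0%N + series (telescope u) n.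
  by apply/funext => n; exact: eq_sum_telescope.
apply: is_cvgD; first exact: is_cvg_cst.
apply: (@normed_cvg _ R^o).
have -> : [normed series (telescope u)] = (fun n => \sum_(0 <= k < n) `|u k - u k.+1|).
  apply/funext => n; rewrite /normed_series_of seriesEnat/=.
  by apply: eq_bigr => k _; rewrite /telescope/= distrC.
apply: nondecreasing_is_cvgn.
  move=> m n mn; rewrite (big_cat_nat _ mn)//= lerDl.
  by apply: sumr_ge0.
exists (fine (\sum_(0 <= k <oo) `|u k - u k.+1|%:E)) => _ [n _ <-].
rewrite -lee_fin fineK; last first.
  by rewrite ge0_fin_numE// nneseries_ge0// => *; rewrite lee_fin.
rewrite -sumEFin.
by apply: nneseries_lim_ge => *; rewrite lee_fin.
Qed.

(** Summable increments in L1 give convergence almost everywhere; the limit is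
set to 0 on the exceptional set, and integrals pass to the limit by domination. *)
Lemma geometric_increments_cvg (h : nat -> T -> R) C : (forall k, unit_function (h k)) ->
  (forall k, \int[mu]_x `|h k x - h k.+1 x| <= C / 2 ^+ k) ->
  exists2 g, unit_function g & forall f, bounded_measurable f ->
    \int[mu]_x (h k x * f x) @[k --> \oo] --> \int[mu]_x (g x * f x).
Proof.
move=> uh hC; pose u k x := `|h k x - h k.+1 x|.
have bu k : bounded_measurable (u k).
  apply: bounded_measurable_norm; apply: bounded_measurableD.
    exact: unit_function_bounded.
  have -> : (fun x => - h k.+1 x) = (fun x => -1 * h k.+1 x) by apply/funext => x; rewrite mulN1r.
  by apply: bounded_measurableZ; exact: unit_function_bounded.
pose G x := (\sum_(0 <= k <oo) (u k x)%:E)%E.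
have u0 k x : (0 <= (u k x)%:E)%E by rewrite lee_fin /u.
have mu_ k : measurable_fun setT (fun x => (u k x)%:E).
  by apply/measurable_EFinP; case: (bu k).
have mG : measurable_fun setT G.
  exact: (@ge0_emeasurable_sum _ _ _ _ (fun k x => (u k x)%:E) xpredT).
have G0 x : (0 <= G x)%E by apply: nneseries_ge0 => *; exact: u0.
have IG : (\int[mu]_x G x < +oo)%E.
  rewrite integral_nneseries//.
  apply: (@le_lt_trans _ _ (2 * C)%:E); last exact: ltry.
  apply: lime_le; first by apply: is_cvg_nneseries => n _ _; apply: integral_ge0.
  apply: nearW => n; rewrite (eq_bigr (fun k => (\int[mu]_x u k x)%:E)); last first.
    by move=> k _; rewrite Rintegral_EFin.
  rewrite sumEFin lee_fin.
  apply: (@le_trans _ _ (C * (2 - 2 / 2 ^+ n))).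
    elim: n => [|n IH]; first by rewrite big_geq// expr0 divr1 subrr mulr0.
    rewrite big_nat_recr//=; apply: (le_trans (lerD IH (hC n))).
    rewrite exprS le_eqVlt; apply/orP; left; apply/eqP; field.
    by rewrite expf_neq0.
  have C0 : 0 <= C.
    by have := hC 0%N; rewrite expr0 divr1; apply: le_trans; apply: Rintegral_ge0.
  rewrite mulrC ler_wpM2r// gerBl divr_ge0// exprn_ge0//.
pose A := [set x | (G x < +oo)%E].
have mA : measurable A.
  by rewrite -[A]setTI; apply: emeasurable_fun_infty_o => //.
have aeA : {ae mu, forall x, A x}.
  have /(integrable_ae measurableT) : mu.-integrable setT G.
    apply/integrableP; split => //.
    by under eq_integral do rewrite gee0_abs//.
  by apply: filterS => x /(_ I); rewrite ge0_fin_numE.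
pose h' k x := h k x * \1_A x.
have cvgA x : A x -> cvgn (h ^~ x) by exact: cvg_of_summable_increments.
pose g x := limn (fun k => h' k x).
have ch' x : cvgn (fun k => h' k x).
  have [Ax|nAx] := pselect (A x).
    rewrite /h' indicE mem_set//; under eq_fun do rewrite mulr1; exact: cvgA.
  rewrite /h' indicE memNset//; under eq_fun do rewrite mulr0; exact: is_cvg_cst.
have mh' k : measurable_fun setT (h' k).
  by apply: measurable_funM; [case: (uh k)|exact: measurable_indic].
have h'01 k x : 0 <= h' k x <= 1.
  have /andP[h0 h1] := (uh k).2 x; rewrite /h' indicE.
  by case: (x \in A); rewrite ?mulr1 ?mulr0 ?h0 ?lexx ?ler01.
have ug : unit_function g.
  split; first by apply: (measurable_fun_cvg mh') => x _; exact: ch'.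
  move=> x; apply/andP; split.
    apply: limr_ge; first exact: ch'.
    by apply: nearW => k; case/andP: (h'01 k x).
  apply: limr_le; first exact: ch'.
  by apply: nearW => k; case/andP: (h'01 k x).
exists g => // f bf; have [mf [B fB]] := bf.
have bhf k : bounded_measurable (fun x => h k x * f x).
  by apply: bounded_measurableM => //; exact: unit_function_bounded.
have bgf : bounded_measurable (fun x => g x * f x).
  by apply: bounded_measurableM => //; exact: unit_function_bounded.
have [|||||_ _] := @dominated_convergence _ _ _ mu setT measurableT
  (fun k x => (h k x * f x)%:E) (fun x => (g x * f x)%:E) (fun=> B%:E).
- by move=> k; apply/measurable_EFinP; case: (bhf k).
- by apply/measurable_EFinP; case: bgf.
- apply: filterS aeA => x Ax _; apply: cvg_EFin; first exact: nearW.
  apply: cvgM; last exact: cvg_cst.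
  rewrite /g /h' indicE mem_set//; under [X in _ --> limn X]eq_fun do rewrite mulr1.
  exact: cvgA.
- exact: (bounded_measurable_integrable _ (bounded_measurable_cst B)).
- apply: aeW => x k _; rewrite lee_fin normrM -[leRHS]mul1r ler_pM//.
  by have /andP[h0 h1] := (uh k).2 x; rewrite ger0_norm.
rewrite Rintegral_EFin// => /fine_cvg; apply: cvg_trans.
exact: cvg_refl.
Qed.

(** The constraints of rank n define a decreasing sequence of convex sets of
densities, whose infimal squared L2 norms m n increase to a finite limit.  Nearly
minimal elements, chosen at ranks nn k where m is within 16^(-k) of that limit, form a
rapid Cauchy sequence by the parallelogram identity. *)
Lemma weak_compactness (Phi : nat -> (T -> R) -> R -> Prop) :
  (forall n f c, Phi n f c -> bounded_measurable f) ->
  (forall m n f c, (m <= n)%N -> Phi m f c -> Phi n f c) ->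
  (forall n, exists2 h, unit_function h & forall f c, Phi n f c -> \int[mu]_x (h x * f x) <= c) ->
  exists2 h, unit_function h & forall n f c, Phi n f c -> \int[mu]_x (h x * f x) <= c.
Proof.
move=> bPhi ndPhi exPhi.
pose adm n h := unit_function h /\ forall f c, Phi n f c -> \int[mu]_x (h x * f x) <= c.
pose N (h : T -> R) := \int[mu]_x (h x * h x).
have N0 h : 0 <= N h by apply: Rintegral_ge0 => x _; rewrite -expr2 sqr_ge0.
pose M := \int[mu]_x (1 : R).
have bsq h : unit_function h -> bounded_measurable (fun x => h x * h x).
  by move=> uh; apply: bounded_measurableM; exact: unit_function_bounded.
have NM h : unit_function h -> N h <= M.
  move=> uh; apply: le_Rintegral_bounded; [exact: bsq|exact: bounded_measurable_cst|].
  by move=> x; have /andP[h0 h1] := uh.2 x; rewrite mulr_ile1.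
pose m n := inf [set N h | h in [set h | adm n h]].
have lbE n : has_lbound [set N h | h in [set h | adm n h]].
  by exists 0 => _ [h _ <-].
have neE n : [set N h | h in [set h | adm n h]] !=set0.
  by have [h uh hP] := exPhi n; exists (N h), h.
have mN n h : adm n h -> m n <= N h by move=> ah; apply: ge_inf => //; exists h.
have adm_anti p n h : (p <= n)%N -> adm n h -> adm p h.
  by move=> pn [uh hP]; split => // f c /(ndPhi _ _ _ _ pn); exact: hP.
have ndm p n : (p <= n)%N -> m p <= m n.
  move=> pn; apply: lb_le_inf => // _ [h ah <-]; apply: mN.
  exact: adm_anti ah.
have supm : has_sup (range m).
  split; first by exists (m 0%N), 0%N.
  exists M => _ [n _ <-]; have [h uh hP] := exPhi n.
  by apply: (le_trans (mN n h _)) => //; exact: NM.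
pose d (k : nat) : R := 16 ^- k.
have d0 k : 0 < d k by rewrite invr_gt0 exprn_gt0.
have /choice[nu hnu] k : exists n, sup (range m) - d k < m n.
  by have [_ [n _ <-] ?] := sup_adherent (d0 k) supm; exists n.
pose nn k := (k + \sum_(i < k.+1) nu i)%N.
have nnS k : (nn k <= nn k.+1)%N.
  rewrite /nn [X in (_ <= _ + X)%N]big_ord_recr/=; apply: leq_add => //; exact: leq_addr.
have nnk k : (k <= nn k)%N by exact: leq_addr.
have hnn k : sup (range m) - d k < m (nn k).
  apply: (lt_le_trans (hnu k)); apply: ndm.
  by rewrite /nn big_ord_recr/= addnA leq_addl.
have msup n : m n <= sup (range m) by apply: sup_upper_bound => //; exists n.
have /choice[h hh] k : exists h, adm (nn k) h /\ N h < m (nn k) + d k.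
  have [_ [h ah <-] ?] := 
    @inf_adherent _ [set N h | h in [set h | adm (nn k) h]] (d k) (d0 k) (conj (neE _) (lbE _)).
  by exists h.
have uh k : unit_function (h k) by have [[]] := hh k.
have key k : \int[mu]_x ((h k x - h k.+1 x) * (h k x - h k.+1 x)) <= 8 * d k.
  have [ahk Nk] := hh k; have [ahk1 Nk1] := hh k.+1.
  pose g x := 2^-1 * h k x + 2^-1 * h k.+1 x.
  have bh j f : bounded_measurable f -> bounded_measurable (fun x => h j x * f x).
    by move=> bf; apply: bounded_measurableM => //; exact: unit_function_bounded.
  have bZ j f : bounded_measurable f -> bounded_measurable (fun x => 2^-1 * (h j x * f x)).
    by move=> bf; apply: bounded_measurableZ; exact: bh.
  have ag : adm (nn k) g.
    split.
      split.
        have := bounded_measurableD _ _ (bounded_measurableZ 2^-1 _ (unit_function_bounded _ (uh k)))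
          (bounded_measurableZ 2^-1 _ (unit_function_bounded _ (uh k.+1))).
        by case.
      move=> x; have /andP[? ?] := (uh k).2 x; have /andP[? ?] := (uh k.+1).2 x.
      by rewrite /g; apply/andP; split; lra.
    move=> f c Pf; have bf := bPhi _ _ _ Pf.
    have -> : (fun x => g x * f x) = (fun x => 2^-1 * (h k x * f x) + 2^-1 * (h k.+1 x * f x)).
      by apply/funext => x; rewrite /g; ring.
    rewrite RintegralD_bounded; [|exact: bZ..].
    rewrite !RintegralZ_bounded; [|exact: bh..].
    have := ahk.2 f c Pf; have := ahk1.2 f c (ndPhi _ _ _ _ (nnS k) Pf); lra.
  have ug := ag.1.
  have bd : bounded_measurable (fun x => (h k x - h k.+1 x) * (h k x - h k.+1 x)).
    have b1 : bounded_measurable (fun x => h k x + -1 * h k.+1 x).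
      apply: bounded_measurableD; first exact: unit_function_bounded.
      by apply: bounded_measurableZ; exact: unit_function_bounded.
    have -> : (fun x => (h k x - h k.+1 x) * (h k x - h k.+1 x)) =
       (fun x => (h k x + -1 * h k.+1 x) * (h k x + -1 * h k.+1 x)).
      by apply/funext => x; ring.
    exact: bounded_measurableM.
  have E : \int[mu]_x ((h k x - h k.+1 x) * (h k x - h k.+1 x))
      + 4 * N g = 2 * N (h k) + 2 * N (h k.+1).
    rewrite -!RintegralZ_bounded; [|by apply: bsq..].
    rewrite -!RintegralD_bounded; [|by [|apply: bounded_measurableZ; apply: bsq]..].
    by congr fine; apply: eq_integral => x _; congr (_%:E); rewrite /g; field.
  have := mN _ _ ag; have := hnn k; have := msup (nn k); have := msup (nn k.+1).
  have : d k.+1 <= d k.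
    by rewrite /d lef_pV2 ?posrE ?exprn_gt0// ler_weXn2l// ler1n.
  lra.
have incr k : \int[mu]_x `|h k x - h k.+1 x| <= (4 + M) / 2 ^+ k.
  have b1 : bounded_measurable (fun x => h k x - h k.+1 x).
    have -> : (fun x => h k x - h k.+1 x) = (fun x => h k x + -1 * h k.+1 x).
      by apply/funext => x; ring.
    apply: bounded_measurableD; first exact: unit_function_bounded.
    by apply: bounded_measurableZ; exact: unit_function_bounded.
  have p0 : (0 : R) < 4 ^+ k by rewrite exprn_gt0.
  apply: (@le_trans _ _ (\int[mu]_x (4 ^+ k / 2 * ((h k x - h k.+1 x) * (h k x - h k.+1 x))
      + (4 ^+ k)^-1 / 2 * 1))).
    apply: le_Rintegral_bounded.
    - exact: bounded_measurable_norm.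
    - apply: bounded_measurableD; last by apply: bounded_measurableZ; exact: bounded_measurable_cst.
      by apply: bounded_measurableZ; exact: bounded_measurableM.
    move=> x; set z := h k x - _.
    have -> : z * z = `|z| * `|z| by rewrite -normrM ger0_norm// -expr2 sqr_ge0.
    (* the inequality of the means, with weights 4^k and 4^(-k) *)
    rewrite -subr_ge0.
    have -> : 4 ^+ k / 2 * (`|z| * `|z|) + (4 ^+ k)^-1 / 2 * 1 - `|z| =
       (4 ^+ k * `|z| - 1) ^+ 2 / (2 * 4 ^+ k) by field; exact: lt0r_neq0.
    by rewrite divr_ge0 ?sqr_ge0// mulr_ge0// ltW.
  rewrite RintegralD_bounded; last 2 first.
  - by apply: bounded_measurableZ; exact: bounded_measurableM.
  - by apply: bounded_measurableZ; exact: bounded_measurable_cst.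
  rewrite !RintegralZ_bounded; last 2 first.
  - exact: bounded_measurable_cst.
  - exact: bounded_measurableM.
  rewrite -/M; have M0 : 0 <= M by apply: Rintegral_ge0.
  apply: (@le_trans _ _ (4 ^+ k / 2 * (8 * d k) + (4 ^+ k)^-1 / 2 * M)).
    by rewrite lerD2r ler_wpM2l// divr_ge0// ltW.
  have -> : 4 ^+ k / 2 * (8 * d k) = 4 * (4 ^+ k)^-1.
    rewrite /d (_ : 16 = 4 * 4); last by ring.
    by rewrite exprMn; field; exact: lt0r_neq0.
  have H1 : (4 ^+ k)^-1 <= (2 ^+ k)^-1 :> R.
    by rewrite lef_pV2 ?posrE ?exprn_gt0// lerXn2r ?nnegrE// ler_nat.
  have H2 : 0 <= (4 ^+ k)^-1 :> R by rewrite invr_ge0 ltW.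
  rewrite [leRHS]mulrDl; apply: lerD; first by rewrite ler_wpM2l.
  have : (4 ^+ k)^-1 / 2 <= (2 ^+ k)^-1 :> R by lra.
  by rewrite [M * _]mulrC; exact: ler_wpM2r.
have [g ug hg] := geometric_increments_cvg h _ uh incr.
exists g => // n f c Pf; have bf := bPhi _ _ _ Pf.
have cg := hg f bf; rewrite -(cvg_lim _ cg)//; apply: limr_le.
  by apply/cvg_ex; eexists; exact: cg.
exists n => // k /= nk; have [[_ ak] _] := hh k; apply: ak.
by apply: ndPhi Pf; exact: leq_trans nk (nnk k).
Qed.

End weak_compactness.

(** * Discretization of a compactly supported measure *)

Section step_functions.
Context {dd : measure_display} {T : measurableType dd} {R : realType}.
Variable mu : {measure set T -> \bar R}.
Hypothesis muT : (mu setT < +oo)%E.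
Variables (I : finType) (Q : I -> set T).
Hypothesis mQ : forall i, measurable (Q i).

Definition step (a : I -> R) (x : T) : R := \sum_i a i * \1_(Q i) x.

Lemma bounded_measurable_indic (A : set T) : measurable A -> bounded_measurable (\1_A : T -> R).
Proof.
move=> mA; split; first exact: measurable_indic.
by exists 1 => x; rewrite indicE; case: (_ \in _); rewrite ?normr0 ?normr1.
Qed.

Lemma Rintegral_sum_bounded (r : seq I) (F : I -> T -> R) :
  (forall i, bounded_measurable (F i)) ->
  bounded_measurable (fun x => \sum_(i <- r) F i x) /\
  \int[mu]_x (\sum_(i <- r) F i x) = \sum_(i <- r) \int[mu]_x F i x.
Proof.
move=> bF; elim: r => [|i r [bS IH]].
  have -> : (fun x => \sum_(i <- [::]) F i x) = (fun=> 0) by apply/funext => x; rewrite big_nil.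
  split; first exact: bounded_measurable_cst.
  by rewrite big_nil Rintegral_cst// mul0r.
have -> : (fun x => \sum_(j <- i :: r) F j x) = (fun x => F i x + \sum_(j <- r) F j x).
  by apply/funext => x; rewrite big_cons.
split; first exact: bounded_measurableD.
by rewrite big_cons -IH; exact: RintegralD_bounded.
Qed.

Lemma step_integral_le (a u : I -> R) (f : T -> R) : bounded_measurable f ->
  (forall i, 0 <= a i) -> (forall i x, Q i x -> f x <= u i) ->
  \int[mu]_x (step a x * f x) <= \sum_i a i * fine (mu (Q i)) * u i.
Proof.
move=> bf a0 fu.
have bI i : bounded_measurable (\1_(Q i) : T -> R) by exact: bounded_measurable_indic.
have bIf i : bounded_measurable (fun x => \1_(Q i) x * f x) by exact: bounded_measurableM.
have -> : (fun x => step a x * f x) = (fun x => \sum_i a i * (\1_(Q i) x * f x)).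
  by apply/funext => x; rewrite /step mulr_suml; apply: eq_bigr => i _; rewrite mulrA.
have [_ ->] := Rintegral_sum_bounded (index_enum I) (fun i x => a i * (\1_(Q i) x * f x))
  (fun i => bounded_measurableZ _ _ (bIf i)).
apply: ler_sum => i _; rewrite RintegralZ_bounded// -mulrA ler_wpM2l//.
apply: (@le_trans _ _ (\int[mu]_x (u i * \1_(Q i) x))).
  apply: le_Rintegral_bounded => //; first exact: bounded_measurableZ.
  move=> x; rewrite indicE; have [xQ|xQ] := boolP (x \in Q i).
    by rewrite mul1r mulr1; apply: fu; rewrite inE in xQ.
  by rewrite mul0r mulr0.
rewrite RintegralZ_bounded// mulrC le_eqVlt; apply/orP; left; apply/eqP.
by rewrite /Rintegral integral_indic// setIT.
Qed.

Lemma step_unit_function (a : I -> R) : (forall i, 0 <= a i <= 1) ->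
  (forall i j x, Q i x -> Q j x -> i = j) -> unit_function (step a).
Proof.
move=> a01 dQ; split.
  have [[//]] := Rintegral_sum_bounded (index_enum I) (fun i x => a i * \1_(Q i) x)
    (fun i => bounded_measurableZ _ _ (bounded_measurable_indic _ (mQ i))).
move=> x; rewrite /step; have [[i Qx]|nQ] := pselect (exists i, Q i x).
  rewrite (bigD1 i)//= indicE mem_set// mulr1 big1 ?addr0// => j ji.
  rewrite indicE memNset ?mulr0// => Qjx; move: ji.
  by rewrite (dQ _ _ _ Qjx Qx) eqxx.
rewrite big1 ?lexx ?ler01// => i _; rewrite indicE memNset ?mulr0// => Qx.
by apply: nQ; exists i.
Qed.

End step_functions.

Section cells.
Variables (R : realType) (d : nat).

Lemma measurable_compact (E : set 'rV[R]_d) : compact E -> measurable E.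
Proof.
move=> cptE; have cE : closed E by exact: compact_closed.
rewrite -[E]setCK; apply: measurableC; apply: open_measurable_rV.
exact: closed_openC.
Qed.

Lemma measure_setT_eq (mu : {measure set 'rV[R]_d -> \bar R}) (E : set 'rV[R]_d) :
  measurable E -> mu (~` E) = 0%E -> mu setT = mu E.
Proof.
move=> mE muE; transitivity (mu E + mu (~` E))%E; last by rewrite muE adde0.
by have := measureU mu mE (measurableC mE) (setICr E); rewrite setUv; exact.
Qed.

(** A finite cover by balls, each ball being deprived of the preceding ones. *)
Lemma compact_cells (E : set 'rV[R]_d) (e : R) : compact E -> 0 < e ->
  exists n (y : 'I_n -> 'rV[R]_d) (Q : 'I_n -> set 'rV[R]_d),
  [/\ forall i, measurable (Q i), forall i j z, Q i z -> Q j z -> i = j,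
      forall i, Q i `<=` eball (y i) e & E = \bigcup_i Q i].
Proof.
move=> cE e0; have := cE; rewrite compact_cover => /(_ _ setT (fun p => eball p e)).
case.
- by move=> p _; exact: open_eball.
- by move=> z Ez; exists z => //; rewrite /eball/= subrr /enorm big1 ?sqrtr0// => i _; rewrite mxE expr0n.
move=> D _ ED; pose s := finmap.enum_fset D.
pose y (i : 'I_(size s)) := nth 0 s i.
pose Q (i : 'I_(size s)) := E `&` (eball (y i) e `&`
  \bigcap_(j in [set j : 'I_(size s) | (j < i)%N]) ~` eball (y j) e).
exists (size s), y, Q; split.
- move=> i; apply: measurableI; first exact: measurable_compact.
  apply: measurableI; first exact: measurable_eball.
  apply: fin_bigcap_measurable => //.
  by move=> j _; apply: measurableC; exact: measurable_eball.
- move=> i j z [_ [yi hi]] [_ [yj hj]]; have [ij|ij|ij] := ltngtP i j; last exact: ord_inj.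
    by have := hj i ij.
  by have := hi j ij.
- by move=> i z [_ []].
apply/seteqP; split => [z Ez|z [i _ []]//].
have [p pD zp] := ED z Ez.
have ex : exists k, (k < size s)%N && `[< eball (nth 0 s k) e z >].
  exists (index p s); rewrite index_mem; apply/andP; split => //.
  by apply/asboolP; rewrite nth_index.
case: (ex_minnP ex) => k /andP[ks /asboolP zk] kmin.
exists (Ordinal ks) => //; split => //; split => //= j /= jk zj.
have := kmin j; rewrite (ltn_ord j)/= => /(_ (asboolT zj)).
by rewrite leqNgt jk.
Qed.

End cells.

Section discretization.
Variables (R : realType) (d n : nat) (s : R).
Hypotheses (s0 : 0 < s) (sn : s + 1 <= n%:R).

Definition trunc_rker (x : 'rV[R]_d) (t : R) (c : 'I_d) (z : 'rV[R]_d) : R :=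
  rker R s ((z - x) 0 c) (trunc_dist R d x t z).

Lemma rker_lip (e u v a c : R) : 0 < e -> e <= a -> e <= c -> `|u| <= a -> `|v| <= c ->
  `|rker R s u a - rker R s v c| <= (`|u - v| + n%:R * `|a - c|) * e `^ (- (s + 1)).
Proof.
move=> e0 ea ec ua vc.
wlog ac : u v a c ea ec ua vc / a <= c.
  move=> W; have [|/ltW ca] := leP a c; first exact: W.
  by rewrite distrC [`|u - v|]distrC [`|a - c|]distrC; exact: W.
have a0 : 0 < a by apply: lt_le_trans ea.
apply: (le_trans (rker_diff R n s u v a c a0 ac s0 sn vc)).
rewrite [`|a - c|]distrC (ger0_norm (x := c - a)) ?subr_ge0//.
apply: ler_wpM2l; first by rewrite addr_ge0// mulr_ge0// subr_ge0.
by apply: ler_npowR => //; rewrite oppr_le0 addr_ge0// ltW.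
Qed.

Lemma trunc_dist_lip (x x' z z' : 'rV[R]_d) (t : R) :
  `|trunc_dist R d x t z - trunc_dist R d x' t z'| <= enorm ((z - x) - (z' - x')).
Proof.
have L := enorm_lip R d (z - x) (z' - x').
rewrite /trunc_dist; set A := enorm (z - x) in L *; set B := enorm (z' - x') in L *.
set C := enorm _ in L *.
have C0 : 0 <= C := enorm_ge0 _ _ _.
move: L; rewrite !ler_norml => /andP[L1 L2].
by case: (leP A t) => h1; case: (leP B t) => h2; apply/andP; split; lra.
Qed.

Lemma trunc_rker_lip (e t : R) (x x' z z' : 'rV[R]_d) c : 0 < e -> e <= t ->
  `|trunc_rker x t c z - trunc_rker x' t c z'| <=
  (1 + n%:R) * enorm ((z - x) - (z' - x')) * e `^ (- (s + 1)).
Proof.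
move=> e0 et.
have te (u w : 'rV[R]_d) : e <= trunc_dist R d u t w by rewrite le_max et orbT.
apply: (le_trans (rker_lip e _ _ _ _ e0 (te _ _) (te _ _) _ _)); rewrite ?coord_le_trunc_dist//.
rewrite ler_wpM2r ?powR_ge0// mulrDl mul1r lerD//.
  apply: le_trans (coord_le_enorm _ _ _ c); by rewrite !mxE.
by rewrite ler_wpM2l// trunc_dist_lip.
Qed.

Lemma trunc_rker_le (t : R) (x z : 'rV[R]_d) c : 0 < t -> `|trunc_rker x t c z| <= t `^ (- s).
Proof.
move=> t0; apply: le_trans (rker_norm _ _ _ _ _ _) _.
- exact: trunc_dist_gt0.
- exact: coord_le_trunc_dist.
apply: ler_npowR => //; first by rewrite oppr_le0 ltW.
by rewrite le_max lexx orbT.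
Qed.

Lemma measurable_trunc_dist (x : 'rV[R]_d) t : measurable_fun setT (trunc_dist R d x t).
Proof.
apply: measurable_maxr; last exact: measurable_cst.
exact: measurable_enormB.
Qed.

Lemma measurable_coordB (x : 'rV[R]_d) c : measurable_fun setT (fun z : 'rV[R]_d => (z - x) 0 c).
Proof.
have -> : (fun z : 'rV[R]_d => (z - x) 0 c) = (fun z => z 0 c + (- x 0 c)).
  by apply/funext => z; rewrite !mxE.
apply: measurable_funD; first exact: measurable_coord.
exact: measurable_cst.
Qed.

Lemma bounded_measurable_trunc_rker x t c : 0 < t -> bounded_measurable (trunc_rker x t c).
Proof.
move=> t0; split; last by exists (t `^ (- s)) => z; exact: trunc_rker_le.
have -> : trunc_rker x t c = (fun z => (z - x) 0 c * trunc_dist R d x t z `^ (- (s + 1))).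
  by apply/funext => z; rewrite powRN.
apply: measurable_funM; first exact: measurable_coordB.
apply: (@measurableT_comp _ _ _ _ _ _ (fun u : R => u `^ (- (s + 1))) _ (trunc_dist R d x t)).
  exact: measurable_powR.
exact: measurable_trunc_dist.
Qed.

End discretization.

(** * A density with bounded truncated potentials *)

Section good_density.
Variables (R : realType) (d n : nat) (s b : R).
Hypotheses (b0 : 0 < b) (b1 : b <= 1) (bs : b <= s) (sn : s + 1 <= n%:R).
Variables (mu : {measure set 'rV[R]_d -> \bar R}) (E : set 'rV[R]_d) (En : R).
Hypotheses (muT : (mu setT < +oo)%E) (cE : compact E) (muE : mu (~` E) = 0%E)
  (M0 : 0 < fine (mu setT)) (En0 : 0 < En) (EnE : wolff_energy s mu = En%:E).

Let M := fine (mu setT).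
Let s0 : 0 < s. Proof. exact: lt_le_trans bs. Qed.

(** Twice the average of the triple potential allowed by the energy bound. *)
Definition energy_level : R := 2 * energy_const R s b * En / M.
Definition energy_scale : R := (Num.sqrt energy_level)^-1.

Local Notation lam := energy_scale.
Local Notation PB := (potential_bound R d n s).

Lemma energy_level_gt0 : 0 < energy_level.
Proof. by rewrite divr_gt0// mulr_gt0// mulr_gt0// energy_const_gt0. Qed.

Lemma energy_scale_gt0 : 0 < lam.
Proof. by rewrite invr_gt0 sqrtr_gt0 energy_level_gt0. Qed.

Lemma energy_scaleE : lam * lam * energy_level = 1.
Proof.
have L0 := energy_level_gt0; rewrite /lam -expr2 exprVn sqr_sqrtr ?(ltW L0)//.
by rewrite mulVf// gt_eqF.
Qed.

Lemma total_massE m (Q : 'I_m -> set 'rV[R]_d) : (forall i, measurable (Q i)) ->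
  (forall i j z, Q i z -> Q j z -> i = j) -> E = \bigcup_i Q i ->
  \sum_i fine (mu (Q i)) = M.
Proof.
move=> mQ dQ EQ; have mE := measurable_compact R d E cE.
have := measure_setT_eq R d mu E mE muE.
rewrite /M => ->.
have := integral_step mu 'I_m Q (fun=> 1) mQ (fun=> ler01).
rewrite (eq_integral (fun x => (\1_E x)%:E)); last first.
  move=> x _; rewrite EQ; have [[i Qx]|nQ] := pselect (exists i, Q i x).
    rewrite (bigD1 i)//= !indicE !mem_set//; last by exists i.
    rewrite mule1 big1 ?adde0// => j ji.
    rewrite indicE memNset ?mule0// => Qjx; move: ji.
    by rewrite (dQ _ _ _ Qjx Qx) eqxx.
  rewrite big1 => [|i _]; last by rewrite indicE memNset ?mule0// => Qx; apply: nQ; exists i.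
  by rewrite indicE memNset// => -[i _ Qx]; apply: nQ; exists i.
rewrite integral_indic// setIT => ->.
under [in RHS]eq_bigr do rewrite mul1e (measure_fineE R d mu muT)//.
by rewrite sumEFin.
Qed.

(** The cells are so small, of size eta, that replacing the kernels by their
values at the centres changes the scaled potentials by at most 1. *)
Lemma discrete_density (e : R) (J : finType) (x : J -> 'rV[R]_d) (t : J -> R) :
  0 < e -> (forall j, e <= t j) ->
  exists2 h : 'rV[R]_d -> R, unit_function h & [/\
    \int[mu]_z (h z * -1) <= - (M / 4),
    forall x0 t0, e <= t0 ->
      \int[mu]_z (h z * \1_(eball x0 t0) z) <= 8 `^ s * t0 `^ s / lam &
    forall j c (sg : bool),
      \int[mu]_z (h z * ((-1) ^+ sg * trunc_rker R d s (x j) (t j) c z)) <= (PB + 1) / lam].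
Proof.
move=> e0 et; have lam0 := energy_scale_gt0.
pose L := lam * M * (1 + n%:R) * e `^ (- (s + 1)).
have L0 : 0 <= L.
  by rewrite mulr_ge0 ?powR_ge0// mulr_ge0// mulr_ge0// ltW.
pose eta := Num.min e (L + 1)^-1.
have L1 : 0 < L + 1 by rewrite ltr_wpDl.
have eta0 : 0 < eta by rewrite lt_min e0 invr_gt0.
have etae : eta <= e by rewrite ge_min lexx.
have etaL : L * eta <= 1.
  apply: (@le_trans _ _ (L * (L + 1)^-1)); first by rewrite ler_wpM2l// ge_min lexx orbT.
  by rewrite ler_pdivrMr// mul1r lerDl.
have [m [y [Q [mQ dQ Qy EQ]]]] := compact_cells R d E eta cE eta0.
pose ms i := fine (mu (Q i)).
have ms0 i : 0 <= ms i by exact: fine_ge0.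
have msM : \sum_i ms i = M by exact: total_massE.
pose D i j := trunc_dist R d (y i) e (y j).
pose V i := \sum_j \sum_k ms j * ms k * triple_weight R s b (D i j) (D i k) (D j k).
have V0 i : 0 <= V i.
  apply: sumr_ge0 => j _; apply: sumr_ge0 => k _; apply: mulr_ge0; first exact: mulr_ge0.
  exact: triple_weight_ge0.
have HV : \sum_i ms i * V i <= energy_const R s b * En.
  have Qe i : Q i `<=` eball (y i) e by move=> z /Qy; rewrite /eball/= => /lt_le_trans; apply.
  by have := energy_le R s b b0 bs d mu muT _ y Q e e0 mQ dQ Qe; rewrite EnE -EFinM lee_fin.
pose good i := V i <= energy_level.
pose w i := if good i then lam * ms i else 0.
have w0 i : 0 <= w i by rewrite /w; case: ifP => // _; rewrite mulr_ge0// ltW.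
have wms i : w i <= lam * ms i by rewrite /w; case: ifP => // _; rewrite mulr_ge0// ltW.
have wV i : 0 < w i -> \sum_j \sum_k w j * w k * triple_weight R s b (D i j) (D i k) (D j k) <= 1.
  rewrite /w; case: ifP => [gi _|]; last by rewrite ltxx.
  apply: (@le_trans _ _ (lam * lam * V i)); last first.
    by rewrite -energy_scaleE ler_wpM2l// mulr_ge0 ?(ltW lam0).
  rewrite /V mulr_sumr; apply: ler_sum => j _; rewrite mulr_sumr; apply: ler_sum => k _.
  move: (triple_weight_ge0 R s b (D i j) (D i k) (D j k)).
  move: (triple_weight _ _ _ _ _ _) => W W0.
  have -> : lam * lam * (ms j * ms k * W) = (lam * ms j) * (lam * ms k) * W by ring.
  rewrite ler_wpM2r//; apply: ler_pM; [exact: (w0 j)|exact: (w0 k)|exact: wms|exact: wms].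
have wM : lam * M / 2 <= \sum_i w i.
  have bad : \sum_(i | ~~ good i) ms i <= M / 2.
    rewrite -(ler_pM2l energy_level_gt0).
    have -> : energy_level * (M / 2) = energy_const R s b * En.
      by rewrite /energy_level -/M; field; exact: lt0r_neq0.
    apply: le_trans HV; rewrite mulr_sumr big_mkcond/=; apply: ler_sum => i _.
    case: ifPn => [|_]; last by rewrite mulr_ge0.
    by rewrite /good -ltNge => /ltW; rewrite mulrC; exact: ler_wpM2l.
  have : \sum_i w i = lam * (M - \sum_(i | ~~ good i) ms i).
    rewrite -msM (bigID good)/= [X in lam * (X - _)](bigID good)/= addrK mulr_sumr.
    rewrite [X in _ + X]big1 ?addr0; first by apply: eq_bigr => i gi; rewrite /w gi.
    by move=> i /negbTE gi; rewrite /w gi.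
  move=> ->; rewrite -mulrA ler_wpM2l ?(ltW lam0)//; lra.
have [h [h01 hw hK]] := @finite_solution R d n s b b0 b1 bs sn _ y w e e0 w0 wV J x t et.
pose a i := if good i then h i else 0.
have a01 i : 0 <= a i <= 1 by rewrite /a; case: ifP => // _; rewrite lexx ler01.
have a0 i : 0 <= a i by case/andP: (a01 i).
have aw i : a i * ms i = w i * h i / lam.
  rewrite /a /w; case: ifP => _; last by rewrite !mul0r.
  by field; exact: lt0r_neq0.
exists (step _ Q a); first exact: (step_unit_function mu muT _ Q mQ a a01 dQ).
split.
- have := step_integral_le mu muT _ Q mQ a (fun=> -1) (fun=> -1) (bounded_measurable_cst _) a0.
  move=> /(_ (fun _ _ _ => lexx _))/le_trans; apply.
  rewrite -mulr_suml mulrN1 lerN2.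
  under eq_bigr do rewrite -/(ms _) aw.
  by rewrite -mulr_suml ler_pdivlMr//; lra.
- move=> x0 t0 et0.
  pose P i := enorm (y i - x0) < 2 * t0.
  have := step_integral_le mu muT _ Q mQ a (fun i => (P i)%:R) (\1_(eball x0 t0))
    (bounded_measurable_indic _ (measurable_eball _ _ _ _)) a0.
  move=> H; apply: (le_trans (H _)) => {H}.
    move=> i z Qz; rewrite indicE; case: (boolP (z \in _)) => [|_]; last by rewrite ler0n.
    rewrite inE /eball/= => zx; have := Qy i z Qz; rewrite /eball/= enormB => zy.
    have T := enorm_triangle R d (y i) z x0.
    by have -> : P i by rewrite /P; lra.
  rewrite ler_pdivlMr//; apply: le_trans (density_le R d s b b0 bs _ y w e e0 w0 wV x0 t0 et0).
  rewrite mulr_suml [leRHS]big_mkcond/=; apply: ler_sum => i _.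
  rewrite -/(ms i) aw -/(P i); case: (P i); last by rewrite mulr0 mul0r.
  rewrite mulr1 mulfVK ?lt0r_neq0//.
  by case/andP: (h01 i) => ? ?; rewrite ler_piMr.
move=> j c sg.
pose K := trunc_rker R d s (x j) (t j) c.
have tj0 : 0 < t j by apply: lt_le_trans (et j).
have bK : bounded_measurable (fun z => (-1) ^+ sg * K z).
  by apply: bounded_measurableZ; exact: bounded_measurable_trunc_rker.
pose r := (1 + n%:R) * eta * e `^ (- (s + 1)).
have r0 : 0 <= r by rewrite mulr_ge0 ?powR_ge0// mulr_ge0// ltW.
have := step_integral_le mu muT _ Q mQ a (fun i => (-1) ^+ sg * K (y i) + r) _ bK a0.
move=> H; apply: (le_trans (H _)) => {H}.
  move=> i z Qz; rewrite -lerBlDl -mulrBr.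
  apply: (le_trans (ler_norm _)); rewrite normrMsign.
  apply: (le_trans (trunc_rker_lip R d n s s0 sn e (t j) _ _ _ _ c e0 (et j))).
  rewrite /r ler_wpM2r ?powR_ge0// ler_wpM2l//.
  by rewrite opprB addrA subrK; exact: ltW (Qy i z Qz).
rewrite ler_pdivlMr//.
under eq_bigr do rewrite mulrDr.
rewrite big_split/= mulrDl lerD//.
  have -> : (\sum_i a i * fine (mu (Q i)) * ((-1) ^+ sg * K (y i))) * lam =
      (-1) ^+ sg * \sum_i w i * K (y i) * h i.
    rewrite mulr_suml mulr_sumr; apply: eq_bigr => i _.
    rewrite -/(ms i) aw; field; exact: lt0r_neq0.
  by apply: (le_trans (ler_norm _)); rewrite normrMsign; exact: hK.
rewrite -mulr_suml; apply: (@le_trans _ _ (M * r * lam)).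
  rewrite ler_wpM2r ?(ltW lam0)// ler_wpM2r// -msM; apply: ler_sum => i _.
  by case/andP: (a01 i) => ? ?; rewrite ler_piMl.
apply: le_trans etaL; rewrite /r /L le_eqVlt; apply/orP; left; apply/eqP; ring.
Qed.

(** The finitely many conditions at rank m come from discrete_density at scale
2^(-m); the limit density satisfies the kernel conditions at rational centres,
and at all centres since the kernels at a fixed scale are Lipschitz. *)
Lemma good_density : exists2 h : 'rV[R]_d -> R, unit_function h & [/\
    M / 4 <= \int[mu]_z h z,
    forall x k, \int[mu]_z (h z * \1_(eball x (2 ^- k)) z) <= 8 `^ s * (2 ^- k) `^ s / lam &
    forall x k c, `|\int[mu]_z (h z * trunc_rker R d s x (2 ^- k) c z)| <= (PB + 2) / lam].
Proof.
have lam0 := energy_scale_gt0.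
have p0 k : (0 : R) < 2 ^- k by rewrite invr_gt0 exprn_gt0.
pose ball_constraint m f c := exists x k, [/\ (k <= m)%N, f = \1_(eball x (2 ^- k)) :> ('rV[R]_d -> R) &
  c = 8 `^ s * (2 ^- k) `^ s / lam].
pose rat_point (p : 'rV[rat]_d) : 'rV[R]_d := map_mx ratr p.
pose kernel_constraint m f c := exists (p : 'rV[rat]_d) k i (sg : bool),
  [/\ (pickle p <= m)%N, (k <= m)%N,
   f = (fun z => (-1) ^+ sg * trunc_rker R d s (rat_point p) (2 ^- k) i z) & c = (PB + 1) / lam].
pose Phi m f c := [\/ f = (fun=> -1) /\ c = - (M / 4), ball_constraint m f c | kernel_constraint m f c].
have bK x k c (sg : bool) : bounded_measurable (fun z => (-1) ^+ sg * trunc_rker R d s x (2 ^- k) c z).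
  by apply: bounded_measurableZ; exact: bounded_measurable_trunc_rker.
have [||m|h uh hP] := weak_compactness mu muT Phi.
- move=> m f c [[-> _]|[x [k [_ -> _]]]|[p [k [i [sg [_ _ -> _]]]]]].
  + exact: bounded_measurable_cst.
  + by apply: bounded_measurable_indic; exact: measurable_eball.
  + exact: bK.
- move=> m m' f c mm [?|[x [k [km ? ?]]]|[p [k [i [sg [pm km ? ?]]]]]].
  + by apply: Or31.
  + by apply: Or32; exists x, k; split => //; exact: leq_trans mm.
  + by apply: Or33; exists p, k, i, sg; split => //; exact: leq_trans mm.
- pose x (j : 'I_m.+1 * 'I_m.+1) : 'rV[R]_d := rat_point (odflt 0 (unpickle j.1)).
  pose t (j : 'I_m.+1 * 'I_m.+1) : R := 2 ^- j.2.
  have te k : (k <= m)%N -> 2 ^- m <= 2 ^- k :> R.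
    by move=> km; rewrite lef_pV2 ?posrE ?exprn_gt0// ler_weXn2l// ler1n.
  have [h uh [h1 h2 h3]] := discrete_density (2 ^- m) _ x t (p0 m) (fun j => te _ (ltn_ord j.2)).
  exists h => // f c [[-> ->]//|[x' [k [km -> ->]]]|[p [k [i [sg [pm km -> ->]]]]]].
    by apply: h2; exact: te.
  have pm' : (pickle p < m.+1)%N by [].
  have km' : (k < m.+1)%N by [].
  by have := h3 (Ordinal pm', Ordinal km') i sg; rewrite /x /t /= pickleK.
have bh := unit_function_bounded h uh.
exists h => //; split.
- have := hP 0%N _ _ (Or31 _ _ (conj erefl erefl)).
  have -> : (fun z => h z * -1) = (fun z => -1 * h z) by apply/funext => z; rewrite mulrC.
  rewrite RintegralZ_bounded//; lra.
- by move=> x k; apply: (hP k); apply: Or32; exists x, k.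
move=> x k c.
pose K x := trunc_rker R d s x (2 ^- k) c.
have bK1 x' : bounded_measurable (K x') by exact: bounded_measurable_trunc_rker.
have bhK x' : bounded_measurable (fun z => h z * K x' z) by exact: bounded_measurableM.
have ratK p : `|\int[mu]_z (h z * K (rat_point p) z)| <= (PB + 1) / lam.
  have H (sg : bool) : \int[mu]_z (h z * ((-1) ^+ sg * K (rat_point p) z)) <= (PB + 1) / lam.
    apply: (hP (maxn (pickle p) k)); apply: Or33; exists p, k, c, sg; split => //.
      exact: leq_maxl.
    exact: leq_maxr.
  have Hs (sg : bool) : (-1) ^+ sg * \int[mu]_z (h z * K (rat_point p) z) <= (PB + 1) / lam.
    rewrite -RintegralZ_bounded//; apply: le_trans (H sg); rewrite le_eqVlt; apply/orP; left; apply/eqP.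
    by congr fine; apply: eq_integral => z _; congr (_%:E); rewrite mulrCA.
  by rewrite ler_norml; have := Hs true; have := Hs false; rewrite expr0 expr1; lra.
pose L := lam * M * (1 + n%:R) * (2 ^- k) `^ (- (s + 1)).
have L0 : 0 <= L.
  by rewrite mulr_ge0 ?powR_ge0// mulr_ge0// mulr_ge0// ltW.
have L1 : 0 < L + 1 by rewrite ltr_wpDl.
have [p xp] := rat_enorm_dense R d x (L + 1)^-1 ltac:(by rewrite invr_gt0).
pose r := (1 + n%:R) * (L + 1)^-1 * (2 ^- k) `^ (- (s + 1)).
have r0 : 0 <= r by rewrite mulr_ge0 ?powR_ge0// mulr_ge0// invr_ge0 ltW.
have Kr z : `|K x z - K (rat_point p) z| <= r.
  apply: (le_trans (trunc_rker_lip R d n s s0 sn (2 ^- k) (2 ^- k) _ _ _ _ c (p0 k) (lexx _))).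
  rewrite ler_wpM2r ?powR_ge0// ler_wpM2l//.
  rewrite (_ : z - x - (z - rat_point p) = - (x - rat_point p)) ?enormN ?(ltW xp)//.
  by rewrite !opprB addrC addrA subrK.
have diff : `|\int[mu]_z (h z * K x z) - \int[mu]_z (h z * K (rat_point p) z)| <= M * r.
  have bdiff : bounded_measurable (fun z => h z * K x z - h z * K (rat_point p) z).
    have -> : (fun z => h z * K x z - h z * K (rat_point p) z) =
      (fun z => h z * K x z + -1 * (h z * K (rat_point p) z)).
      by apply/funext => z; rewrite mulN1r.
    by apply: bounded_measurableD => //; exact: bounded_measurableZ.
  rewrite -RintegralB//; [|exact: bounded_measurable_integrable..].
  apply: (le_trans (le_normr_Rintegral measurableT _)).
    exact: bounded_measurable_integrable.
  apply: (@le_trans _ _ (\int[mu]_z r)); last by rewrite Rintegral_cst// mulrC.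
  apply: le_Rintegral_bounded => //.
  - exact: bounded_measurable_norm.
  - exact: bounded_measurable_cst.
  move=> z; rewrite -mulrBr normrM.
  have /andP[h0 h1] := uh.2 z; rewrite (ger0_norm h0).
  by apply: le_trans (Kr z); rewrite ler_piMl.
have lr : M * r <= lam^-1.
  rewrite -(ler_pM2l lam0) divff ?lt0r_neq0//.
  have -> : lam * (M * r) = L * (L + 1)^-1 by rewrite /r /L; ring.
  by rewrite ler_pdivrMr// mul1r lerDl.
have -> : (PB + 2) / lam = (PB + 1) / lam + lam^-1 by ring.
rewrite -[X in `|X|](subrK (\int[mu]_z (h z * K (rat_point p) z))).
apply: (le_trans (ler_normD _ _)); rewrite [leLHS]addrC.
by apply: lerD; [exact: ratK|exact: le_trans diff lr].
Qed.

End good_density.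

(** * Measures given by a density *)

Section density_measure.
Context {dd : measure_display} {T : measurableType dd} {R : realType}.
Variables (mu : {measure set T -> \bar R}) (g : T -> R).
Hypotheses (mg : measurable_fun [set: T] g) (g0 : forall x, 0 <= g x).
Local Open Scope ereal_scope.

Definition density (A : set T) : \bar R := \int[mu]_(x in A) (g x)%:E.

Let mgE D : measurable_fun D (fun x => (g x)%:E).
Proof. by apply/measurable_EFinP; exact: measurable_funTS. Qed.

Let density0 : density set0 = 0.
Proof. by rewrite /density integral_set0. Qed.

Let density_ge0 A : 0 <= density A.
Proof. by apply: integral_ge0 => x _; rewrite lee_fin. Qed.

Let density_sigma_additive : semi_sigma_additive density.
Proof.
move=> A mA tA mUA; rewrite /density ge0_integral_bigcup//; last first.
  by move=> x _; rewrite lee_fin.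
by apply: is_cvg_ereal_nneg_natsum_cond => n _ _; exact: density_ge0.
Qed.

HB.instance Definition _ := isMeasure.Build _ _ _ density
  density0 density_ge0 density_sigma_additive.

Import HBNNSimple.

Let integral_density_nnsfun (f : {nnsfun T >-> R}) :
  \int[density]_x (f x)%:E = \int[mu]_x ((f x)%:E * (g x)%:E).
Proof.
rewrite integralT_nnsfun sintegralE.
transitivity (\int[mu]_x (\sum_(r \in range f) (r%:E * ((\1_(f @^-1` [set r]) x)%:E * (g x)%:E)))).
  rewrite ge0_integral_fsum//; last 2 first.
  - move=> r; apply: measurable_funeM; apply: emeasurable_funM => //.
    by apply/measurable_EFinP; exact: measurable_indic.
  - move=> r x _; rewrite muleA -EFinM; have := nnfun_muleindic_ge0 f r x.
    by rewrite EFinM => h; rewrite mule_ge0// lee_fin.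
  apply: eq_fsbigr => r; rewrite inE => -[x _ <-].
  rewrite ge0_integralZl_EFin//; last 2 first.
  - by move=> y _; rewrite mule_ge0 ?lee_fin.
  - apply: emeasurable_funM => //.
    by apply/measurable_EFinP; exact: measurable_indic.
  congr (_ * _); rewrite /= /density integral_mkcond.
  apply: eq_integral => y _; rewrite patchE indicE.
  by case: ifP => _; rewrite ?mul1e ?mul0e.
apply: eq_integral => x _.
rewrite [in RHS]fimfunE -fsumEFin// ge0_mule_fsuml//.
  by apply: eq_fsbigr => r _; rewrite EFinM muleA.
by move=> r; exact: nnfun_muleindic_ge0.
Qed.

Lemma ge0_integral_density (f : T -> \bar R) : measurable_fun setT f -> (forall x, 0 <= f x) ->
  \int[density]_x f x = \int[mu]_x (f x * (g x)%:E).
Proof.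
move=> mf f0; pose f_ := nnsfun_approx measurableT mf.
have cf x : (f_ n x)%:E @[n --> \oo] --> f x by apply: cvg_nnsfun_approx.
have ndf x m n : (m <= n)%N -> ((f_ m x)%:E <= (f_ n x)%:E)%E.
  by move=> mn; rewrite lee_fin; exact/lefP/nd_nnsfun_approx.
transitivity (limn (fun n => \int[density]_x (f_ n x)%:E)).
  rewrite -monotone_convergence//.
  - by apply: eq_integral => x _; apply/esym/cvg_lim.
  - by move=> n; exact/measurable_EFinP/measurable_funP.
  - by move=> n x _; rewrite lee_fin.
  - by move=> x _ m n mn; exact: ndf.
under eq_fun do rewrite integral_density_nnsfun.
rewrite -monotone_convergence//.
- apply: eq_integral => x _; apply/cvg_lim => //.
  by apply: cvgeZr => //; exact: cf.
- move=> n; apply: emeasurable_funM => //.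
  exact/measurable_EFinP/measurable_funP.
- by move=> n x _; rewrite mule_ge0// lee_fin.
- by move=> x _ m n mn; rewrite lee_wpmul2r ?lee_fin//; exact/lefP/nd_nnsfun_approx.
Qed.

Lemma integral_density (f : T -> \bar R) : measurable_fun setT f ->
  \int[density]_x f x = \int[mu]_x (f x * (g x)%:E).
Proof.
move=> mf; rewrite [LHS]integralE [RHS]integralE !ge0_integral_density//; last 2 first.
- exact: measurable_funeneg.
- exact: measurable_funepos.
congr (_ - _); apply: eq_integral => x _.
- by rewrite !funeposE maxe_pMl ?lee_fin// mul0e.
- by rewrite !funenegE maxe_pMl ?lee_fin// mul0e mulNe.
Qed.

Lemma integral_eq_density (rho : {measure set T -> \bar R}) (f : T -> \bar R) :
  (forall A, rho A = density A) -> measurable_fun setT f ->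
  \int[rho]_x f x = \int[mu]_x (f x * (g x)%:E).
Proof.
move=> rhoE mf; rewrite -integral_density//.
by apply: eq_measure_integral => A _ _; exact: rhoE.
Qed.

Lemma density_measure_exists : exists rho : {measure set T -> \bar R},
  forall A, rho A = density A.
Proof. by exists density. Qed.

End density_measure.

(** * Admissibility for the capacity *)

Section admissible.
Variables (R : realType) (d : nat).
Implicit Types (mu rho : {measure set 'rV[R]_d -> \bar R}).

Lemma M_plus_lty (E : set 'rV[R]_d) mu : compact E -> M_plus E mu -> (mu setT < +oo)%E.
Proof.
move=> cE [rmu muE]; rewrite (measure_setT_eq R d mu E (measurable_compact R d E cE) muE).
exact: rmu.1.
Qed.

(** Inner regularity passes to rho because rho (A \ K) <= B mu (A \ K). *)
Lemma radon_density mu (g : 'rV[R]_d -> R) (rho : {measure set 'rV[R]_d -> \bar R}) (B : R) :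
  radon mu -> (mu setT < +oo)%E -> measurable_fun setT g -> (forall z, 0 <= g z <= B) ->
  (forall A, rho A = density mu g A) -> radon rho.
Proof.
move=> [mu1 mu2] muT mg gB rhoE.
have B0 : 0 <= B by have /andP[] := gB 0; exact: le_trans.
have rho_le A : measurable A -> (rho A <= B%:E * mu A)%E.
  move=> mA; rewrite rhoE /density -integral_cst//; apply: ge0_le_integral => //.
  - by move=> z _; rewrite lee_fin; have /andP[] := gB z.
  - by apply/measurable_EFinP; exact: measurable_funTS.
  - by move=> z _; rewrite lee_fin; have /andP[] := gB z.
have B1 : 0 < B + 1 by rewrite ltr_wpDl.
split.
  move=> K cK; have mK := measurable_compact R d K cK.
  apply: (le_lt_trans (rho_le K mK)).
  by rewrite (measure_fineE R d mu muT)// -EFinM ltry.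
move=> A mA; apply/eqP; rewrite eq_le; apply/andP; split; last first.
  apply: ge_ereal_sup => _ [K [cK KA] <-]; apply: le_measure => //; rewrite inE//.
  exact: measurable_compact.
apply/lee_addgt0Pr => e e0.
have Afin := measure_fineE R d mu muT A mA.
have eB : 0 < e / (B + 1) by rewrite divr_gt0.
have [_ [K [cK KA] <-] hK] : exists2 x, [set mu K | K in [set K | compact K /\ K `<=` A]] x &
    (mu A - (e / (B + 1))%:E < x)%E.
  apply: ereal_sup_gt; rewrite -mu2// Afin -EFinB lte_fin; lra.
have mK := measurable_compact R d K cK.
have mAK : measurable (A `\` K) by exact: measurableD.
have muAK : (mu (A `\` K) <= (e / (B + 1))%:E)%E.
  have KAE : A `&` K = K by apply/setIidPr.
  rewrite measureD//=; last by rewrite Afin ltry.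
  rewrite KAE; move: hK; rewrite Afin (measure_fineE R d mu muT K mK) -!EFinB lte_fin lee_fin; lra.
have -> : rho A = (rho (A `&` K) + rho (A `\` K))%E.
  by rewrite addeC; exact: measureDI.
have -> : A `&` K = K by apply/setIidPr.
apply: leeD; first by apply: ereal_sup_ubound; exists K.
apply: (le_trans (rho_le _ mAK)); apply: (@le_trans _ _ (B%:E * (e / (B + 1))%:E)%E).
  by rewrite lee_wpmul2l// lee_fin.
rewrite -EFinM lee_fin mulrCA ger_pMr// ler_pdivrMr// mul1r; lra.
Qed.

Lemma exp2V_cvg_at_right0 (f : R -> R) (l : R) : f e @[e --> 0^'+] --> l ->
  f (2 ^- k.+1) @[k --> \oo] --> l.
Proof.
move=> /cvg_at_rightP; apply; split; first by move=> k; rewrite invr_gt0 exprn_gt0.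
have h : `|2^-1 : R| < 1 by rewrite ger0_norm// invf_lt1// ltr1n.
have H := cvg_geometric (1 : R) h.
move: H; rewrite -(@cvg_shiftS R^o); apply: cvg_trans; apply: near_eq_cvg.
by apply: nearW => k; rewrite /geometric/= mul1r exprVn.
Qed.

(** It suffices to bound the truncations along the scales 2^(-k-1): where the
limit defining riesz does not exist, riesz is the default value 0. *)
Lemma riesz_Linfty_le1 (s C : R) rho : 0 <= C -> d%:R * C <= 1 ->
  (forall x k c, `|riesz_trunc s rho x (2 ^- k.+1) 0 c| <= C) -> (riesz_Linfty s rho <= 1)%E.
Proof.
move=> C0 dC H; rewrite /riesz_Linfty unlock.
case: ifP => // _; apply/ess_sup_inf.ess_supP; apply: aeW => x /=.
rewrite ger0_norm ?enorm_ge0// lee_fin; apply: le_trans dC.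
apply: (le_trans (enorm_le_sum _ _ _)).
rewrite mulr_natl -[d in leRHS]card_ord -sumr_const; apply: ler_sum => c _.
rewrite /riesz; have [cvgx|dvgx] := pselect (cvg (riesz_trunc s rho x e @[e --> 0^'+])); last first.
  by rewrite (dvgP dvgx) !mxE normr0.
set l := lim _.
have cl : riesz_trunc s rho x e 0 c @[e --> 0^'+] --> l 0 c.
  exact: (cvg_comp (riesz_trunc s rho x) (fun A : 'rV[R]_d => A 0 c) cvgx (@coord_continuous R 1 d 0 c l)).
have /cvg_norm cl2 := exp2V_cvg_at_right0 (fun e => riesz_trunc s rho x e 0 c) _ cl.
rewrite -(cvg_lim _ cl2)//; apply: limr_le; first by apply/cvg_ex; eexists; exact: cl2.
by apply: nearW => k; exact: H.
Qed.

(** The sharply truncated kernel and K_t agree beyond t, and K_t is at most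
t^(-s) on the ball of radius t. *)
Lemma riesz_trunc_density_le mu (s a C1 C2 t : R) (h : 'rV[R]_d -> R)
    (rho : {measure set 'rV[R]_d -> \bar R}) x c :
  0 < s -> (mu setT < +oo)%E -> unit_function h -> 0 <= a -> 0 < t ->
  (forall A, rho A = density mu (fun z => a * h z) A) ->
  \int[mu]_z (h z * \1_(eball x (2 * t)) z) <= C1 * t `^ s ->
  `|\int[mu]_z (h z * trunc_rker R d s x t c z)| <= C2 ->
  `|riesz_trunc s rho x t 0 c| <= a * (C1 + C2).
Proof.
move=> s0 muT uh a0 t0 rhoE hC1 hC2.
pose D := [set y | t < enorm (y - x)].
pose K := trunc_rker R d s x t c.
have mD : measurable D.
  have -> : D = (fun y => enorm (y - x)) @^-1` `]t, +oo[%classic.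
    by apply/seteqP; split => y; rewrite /D/= in_itv/= andbT.
  by rewrite -[X in measurable X]setTI; apply: measurable_enormB.
have bh := unit_function_bounded h uh.
have bK : bounded_measurable K by exact: bounded_measurable_trunc_rker.
have bhK : bounded_measurable (fun z => h z * K z) by exact: bounded_measurableM.
have bD := bounded_measurable_indic D mD : bounded_measurable (\1_D : 'rV[R]_d -> R).
have bKD : bounded_measurable (fun z => K z * \1_D z) by exact: bounded_measurableM.
have bhKD : bounded_measurable (fun z => h z * (K z * \1_D z)) by exact: bounded_measurableM.
pose g z := a * h z.
have mg : measurable_fun setT g by have [] := bounded_measurableZ a h bh.
have g0 z : 0 <= g z by rewrite mulr_ge0//; have /andP[] := uh.2 z.
have -> : riesz_trunc s rho x t 0 c = a * \int[mu]_z (h z * (K z * \1_D z)).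
  rewrite mxE Rintegral_mkcond -RintegralZ_bounded// /Rintegral; congr fine.
  transitivity (\int[rho]_z (K z * \1_D z)%:E)%E.
    apply: eq_integral => z _; congr (_%:E); rewrite patchE indicE /D.
    have [|_] := boolP (z \in _); last by rewrite mulr0.
    rewrite inE/= => tz; rewrite mulr1 /K /trunc_rker /rker /trunc_dist.
    by rewrite (max_l (ltW tz)).
  rewrite (integral_eq_density mu g mg g0 rho _ rhoE); last first.
    by apply/measurable_EFinP; case: bKD.
  by apply: eq_integral => z _; rewrite -EFinM; congr (_%:E); rewrite /g; ring.
rewrite normrM (ger0_norm a0) ler_wpM2l//.
have bB := bounded_measurable_indic _ (measurable_eball R d x (2 * t)) :
  bounded_measurable (\1_(eball x (2 * t)) : 'rV[R]_d -> R).
have bhB : bounded_measurable (fun z => h z * \1_(eball x (2 * t)) z) by exact: bounded_measurableM.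
have bdiff : bounded_measurable (fun z => h z * (K z * \1_D z) - h z * K z).
  have -> : (fun z => h z * (K z * \1_D z) - h z * K z) =
    (fun z => h z * (K z * \1_D z) + -1 * (h z * K z)) by apply/funext => z; rewrite mulN1r.
  by apply: bounded_measurableD => //; exact: bounded_measurableZ.
rewrite -[X in `|X|](subrK (\int[mu]_z (h z * K z))).
apply: (le_trans (ler_normD _ _)); apply: lerD; last exact: hC2.
rewrite -RintegralB//; [|exact: bounded_measurable_integrable..].
apply: (le_trans (le_normr_Rintegral measurableT _)).
  exact: bounded_measurable_integrable.
have ts0 : 0 < t `^ s by rewrite powR_gt0.
apply: (@le_trans _ _ (t `^ (- s) * \int[mu]_z (h z * \1_(eball x (2 * t)) z))); last first.
  by rewrite powRN mulrC ler_pdivrMr.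
rewrite -RintegralZ_bounded//; apply: le_Rintegral_bounded => //.
- exact: bounded_measurable_norm.
- exact: bounded_measurableZ.
move=> z; rewrite -mulrBr normrM mulrCA.
have /andP[h0 _] := uh.2 z; rewrite (ger0_norm h0); apply: ler_wpM2l => //.
rewrite !indicE; have [|zD] := boolP (z \in D).
  by rewrite mulr1 subrr normr0 mulr_ge0 ?powR_ge0.
have zt : enorm (z - x) <= t by rewrite leNgt; apply/negP => tz; move/negP: zD; apply; rewrite inE.
rewrite mulr0 sub0r normrN mem_set ?mulr1; first exact: trunc_rker_le.
by rewrite /eball/=; lra.
Qed.

End admissible.

(** * The capacity inequality *)

Section capacity_lower_bound.
Variables (R : realType) (d : nat) (s : R).
Hypotheses (hd : (1 <= d)%N) (s0 : 0 < s) (sd : s < d%:R).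

Let b : R := Num.min 1 s.
Let b0 : 0 < b. Proof. by rewrite lt_min ltr01. Qed.
Let b1 : b <= 1. Proof. by rewrite ge_min lexx. Qed.
Let bs : b <= s. Proof. by rewrite ge_min lexx orbT. Qed.
Let sn : s + 1 <= d.+1%:R.
Proof. by rewrite -natr1 lerD2r ltW. Qed.

(** The ball term of riesz_trunc_density_le, at scale t and for the ball of radius
2 t, is 8^s (2 t)^s = 16^s t^s; the rest is the kernel bound of good_density. *)
Definition riesz_bound : R := 16 `^ s + (potential_bound R d d.+1 s + 2).
(** Normalizes the sum of the d coordinates of the transform to at most 1. *)
Definition capacity_scale : R := (d%:R * riesz_bound)^-1.
(** The factor left when capacity_scale * energy_scale * M / 4 is written as a
multiple of M^(3/2) En^(-1/2). *)
Definition capacity_const : R := capacity_scale / (4 * Num.sqrt (2 * energy_const R s b)).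

Let d0 : (0 : R) < d%:R. Proof. by rewrite ltr0n. Qed.

Lemma riesz_bound_gt0 : 0 < riesz_bound.
Proof.
by rewrite /riesz_bound /potential_bound ltr_wpDl ?powR_ge0// addr_gt0.
Qed.

Lemma capacity_scale_gt0 : 0 < capacity_scale.
Proof. by rewrite invr_gt0 mulr_gt0// riesz_bound_gt0. Qed.

Lemma capacity_const_gt0 : 0 < capacity_const.
Proof.
rewrite divr_gt0 ?capacity_scale_gt0// mulr_gt0// sqrtr_gt0 mulr_gt0//.
exact: energy_const_gt0.
Qed.

Lemma gamma_plus_ge0 (E : set 'rV[R]_d) : (0 <= gamma_plus s E)%E.
Proof.
have rad : radon (mzero : {measure set 'rV[R]_d -> \bar R}).
  split; first by move=> K _; rewrite /mzero ltry.
  move=> A _; apply/eqP; rewrite eq_le; apply/andP; split.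
    by apply: ereal_sup_ubound; exists set0 => //; split => //; exact: compact0.
  by apply: ge_ereal_sup => _ [K _ <-].
apply: ereal_sup_ubound; exists mzero => //; split; first by split.
have dC : d%:R * 0 <= 1 :> R by rewrite mulr0.
apply: (riesz_Linfty_le1 R d s 0 mzero (lexx _) dC).
by move=> x k c; rewrite mxE /Rintegral integral_measure_zero normr0.
Qed.

Lemma energy_le_gamma_plus (E : set 'rV[R]_d) (mu : {measure set 'rV[R]_d -> \bar R}) (En : R) :
  compact E -> M_plus E mu -> mu setT != 0%E -> wolff_energy s mu = En%:E -> 0 < En ->
  ((capacity_const * (fine (mu setT) * Num.sqrt (fine (mu setT)) / Num.sqrt En))%:E
    <= gamma_plus s E)%E.
Proof.
move=> cE [rmu muE] mu0 EnE En0.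
have muT := M_plus_lty R d E mu cE (conj rmu muE).
have muTE := measure_fineE R d mu muT setT measurableT.
set M := fine (mu setT) in muTE *.
have M0 : 0 < M.
  rewrite lt_neqAle fine_ge0// andbT eq_sym; apply: contra mu0 => /eqP h.
  by rewrite muTE h.
have [h uh [hM hball hker]] := good_density R d d.+1 s b b0 b1 bs sn mu E En muT cE muE M0 En0 EnE.
have lam0 := energy_scale_gt0 R d s b b0 mu En M0 En0.
set lam := energy_scale R d s b mu En in hball hker lam0.
pose a := capacity_scale * lam.
have k0 := capacity_scale_gt0.
have a0 : 0 < a by rewrite mulr_gt0.
have bh := unit_function_bounded h uh.
have [mg _] := bounded_measurableZ a h bh.
have g0 z : 0 <= a * h z by rewrite mulr_ge0 ?(ltW a0)//; have /andP[] := uh.2 z.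
have [rho rhoE] := density_measure_exists mu (fun z => a * h z) mg g0.
have rhoT : rho setT = (a * \int[mu]_z h z)%:E.
  rewrite rhoE /density -RintegralZ_bounded// -Rintegral_EFin//.
  exact: bounded_measurableZ.
apply: (@le_trans _ _ (rho setT)).
  rewrite rhoT lee_fin; apply: (@le_trans _ _ (a * (M / 4))); last by rewrite ler_pM2l.
  rewrite /a /lam /energy_scale /capacity_const /energy_level -/M.
  have e0 : 0 < 2 * energy_const R s b by rewrite mulr_gt0// energy_const_gt0.
  have -> : Num.sqrt (2 * energy_const R s b * En / M) =
      Num.sqrt (2 * energy_const R s b) * Num.sqrt En / Num.sqrt M.
    have e1 : 0 <= 2 * energy_const R s b * En by apply: mulr_ge0; exact: ltW.
    by rewrite (sqrtrM _ e1) (sqrtrM _ (ltW e0)) sqrtrV// ltW.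
  have : 0 < Num.sqrt (2 * energy_const R s b) by rewrite sqrtr_gt0.
  have : 0 < Num.sqrt M by rewrite sqrtr_gt0.
  have : 0 < Num.sqrt En by rewrite sqrtr_gt0.
  move: (Num.sqrt (2 * _)) (Num.sqrt M) (Num.sqrt En) => x1 x2 x3 *.
  rewrite le_eqVlt; apply/orP; left; apply/eqP; field.
  by rewrite !gt_eqF.
apply: ereal_sup_ubound; exists rho => //; split.
  split.
    apply: (radon_density R d mu (fun z => a * h z) rho a rmu muT mg _ rhoE) => z.
    by rewrite g0/= ger_pMr//; have /andP[] := uh.2 z.
  rewrite rhoE /density; apply: null_set_integral => //; first by apply: measurableC; exact: measurable_compact.
  by apply/measurable_EFinP; exact: measurable_funTS.
apply: (riesz_Linfty_le1 R d s (capacity_scale * riesz_bound)).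
- by rewrite mulr_ge0 ?(ltW k0)// ltW// riesz_bound_gt0.
- rewrite mulrCA mulVf// gt_eqF// mulr_gt0//; exact: riesz_bound_gt0.
move=> x k c.
have t0 : (0 : R) < 2 ^- k.+1 by rewrite invr_gt0 exprn_gt0.
have -> : capacity_scale * riesz_bound =
    a * (16 `^ s / lam + (potential_bound R d d.+1 s + 2) / lam).
  by rewrite /a /riesz_bound; field; exact: lt0r_neq0.
apply: (riesz_trunc_density_le R d mu s a _ _ (2 ^- k.+1) h rho) => //; first exact: ltW.
have e2 : 2 * 2 ^- k.+1 = 2 ^- k :> R by rewrite exprS; field; rewrite expf_neq0.
rewrite e2; apply: (le_trans (hball x k)); rewrite -e2 powRM ?(ltW t0)//.
rewrite mulrA -powRM// (_ : 8 * 2 = 16); last by ring.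
by rewrite mulrAC.
Qed.

End capacity_lower_bound.

Theorem theorem4p7 (R : realType) (d : nat) (s : R)
    (hd : (1 <= d)%N) (hs0 : 0 < s) (hsd : s < d%:R) :
  exists c : R, 0 < c /\
    forall E : set 'rV[R]_d, compact E ->
      (c%:E * wolff_sup s E <= gamma_plus s E)%E.
Proof.
have c0 := capacity_const_gt0 R d s hd hs0.
exists (capacity_const R d s); split => // E cE.
rewrite -lee_pdivlMl//; apply: ge_ereal_sup => v; rewrite lee_pdivlMl//.
have gamma0 := gamma_plus_ge0 R d s E.
move=> [->|[mu [Emu mu0] <-]]; first by rewrite mule0.
rewrite /wolff_term; case: ifPn => [_|Efin]; first by rewrite mule0.
have muT := M_plus_lty R d E mu cE Emu.
have W0 : (0 <= wolff_energy s mu)%E.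
  by apply: integral_ge0 => z _; exact: wolff_ge0.
have EnE : wolff_energy s mu = (fine (wolff_energy s mu))%:E.
  by rewrite fineK// ge0_fin_numE// lt_neqAle Efin leey.
set En := fine _ in EnE.
have [En0|En0] := ltP 0 En; last first.
  have -> : wolff_energy s mu = 0%E by apply/le_anti; rewrite W0 andbT EnE lee_fin.
  rewrite (_ : 0%E `^ _ = 0)%E ?mule0//.
  by rewrite poweR_EFin powR0// oppr_eq0.
apply: le_trans (energy_le_gamma_plus R d s hd hs0 hsd E mu En cE Emu mu0 EnE En0).
rewrite EnE (measure_fineE R d mu muT setT measurableT) !poweR_EFin -!EFinM lee_fin.
have M0 : 0 <= fine (mu setT) by exact: fine_ge0.
rewrite ler_wpM2l ?(ltW c0)//.
rewrite powRN (_ : 1 / 2 = 2^-1); last by rewrite div1r.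
rewrite powR12_sqrt ?(ltW En0)// (_ : 3 / 2 = 1 + 2^-1); last by field.
by rewrite powRD ?powRr1 ?powR12_sqrt//; apply/implyP => /eqP; lra.
Qed.
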